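(* Let $\{X_n\}_{n\ge1}$ be a strictly stationary sequence of centered, square integrable, associated random variables with $\sum_{j=1}^\infty c_j<\infty$, where $c_j=\mathrm{Cov}(X_1,X_{1+j})$, and $\sigma^2:=E X_1^2+2\sum_{j=1}^\infty c_j>0$. Let $S_n=\sum_{j=1}^nX_j$, $s_n^2=ES_n^2$. Assume (A1) $E|X_1|^q<\infty$ for some $q>2$, and (A2) $\left|\frac{s_n^2}{n\sigma^2}-1\right|=O(n^{-\theta})$ for some $\theta>0$. Let $x_n$ be a sequence such that (i) $\limsup_{n\to\infty}\frac{x_n^2}{\log n}=\lambda<\frac{q-2}{2}$, and (ii) $\theta>1+\lambda$. Then, with $\Phi$ the standard normal distribution function, $$P(S_n>x_ns_n)=(1-\Phi(x_n))(1+o(1))\quad (n\to\infty).$$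
   Context: Associated: $\mathrm{Cov}(f(X_1,\dots,X_k),g(X_1,\dots,X_k))\ge0$ for all coordinatewise nondecreasing $f,g$ for which it exists, for every finite initial segment. *)

(* Defs.v *)
From HB Require Import structures.
From mathcomp Require Import all_boot all_order all_algebra.
From mathcomp Require Import all_classical all_reals all_analysis.
Set Implicit Arguments. Unset Strict Implicit. Unset Printing Implicit Defensive.
Import Order.TTheory GRing.Theory Num.Theory.
Import numFieldNormedType.Exports.
Local Open Scope classical_set_scope.
Local Open Scope ring_scope.

Section defs.
Context {d : measure_display} {T : measurableType d} {R : realType}.
Variable P : probability T R.

(* The sequence X_1, X_2, ... is represented by X 0, X 1, ... *)

(* strict stationarity: finite-dimensional distributions (on measurable
   rectangles, which determine the joint law) are shift invariant *)
Definition strictly_stationary (X : nat -> T -> R) : Prop :=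
  forall (k m : nat) (B : 'I_k -> set R), (forall i, measurable (B i)) ->
    P [set w | forall i : 'I_k, B i (X (m + i)%N w)] =
    P [set w | forall i : 'I_k, B i (X (nat_of_ord i) w)].

Definition coord_nondecreasing (k : nat) (f : ('I_k -> R) -> R) : Prop :=
  forall u v : 'I_k -> R, (forall i, u i <= v i) -> f u <= f v.

Definition associated (X : nat -> T -> R) : Prop :=
  forall (k : nat) (f g : ('I_k -> R) -> R),
    coord_nondecreasing f -> coord_nondecreasing g ->
    let F := fun w => f (fun i => X (nat_of_ord i) w) in
    let G := fun w => g (fun i => X (nat_of_ord i) w) in
    P.-integrable [set: T] (EFin \o F) ->
    P.-integrable [set: T] (EFin \o G) ->
    P.-integrable [set: T] (EFin \o (F \* G)) ->
    (0 <= covariance P F G)%E.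

Definition cov_seq (X : nat -> T -> R) (j : nat) : R :=
  fine (covariance P (X 0%N) (X j)).

Definition sigma2 (X : nat -> T -> R) : R :=
  fine ('E_P[fun w => X 0%N w ^+ 2]) + 2 * limn (series (fun j => cov_seq X j.+1)).

Definition partial_sum (X : nat -> T -> R) (n : nat) : T -> R :=
  fun w => \sum_(j < n) X j w.

Definition sn (X : nat -> T -> R) (n : nat) : R :=
  Num.sqrt (fine ('E_P[fun w => partial_sum X n w ^+ 2])).

End defs.

Definition Phi {R : realType} (x : R) : R :=
  fine (normal_prob (0:R) 1 `]-oo, x]).

(* Main.v *)
Require Import Defs.
From HB Require Import structures.
From mathcomp Require Import all_boot all_order all_algebra.
From mathcomp Require Import all_classical all_reals all_analysis.
From mathcomp Require Import measurable_realfun ring lra.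
Set Implicit Arguments.
Unset Strict Implicit.
Unset Printing Implicit Defensive.
Import Order.TTheory GRing.Theory Num.Theory.
Import numFieldNormedType.Exports.
Local Open Scope classical_set_scope.
Local Open Scope ring_scope.

(* Rate (A2) with theta > 1 forces every covariance to vanish, since
   n sigma^2 - s_n^2 is nondecreasing in n and starts at twice the sum of the
   covariances; hence s_n = sigma sqrt n. By Newman's argument, association
   without correlation makes Lipschitz functions of X_0 + ... + X_(k-1) and of
   X_k uncorrelated, so Lindeberg's replacement scheme works as for independent
   variables. It is run on variables truncated at n^(1/2 - eps), along the heat
   flow w(t, y) = 1 - Phi((x - y) / sqrt t), whose derivatives are controlled by
   the weight exp(- x^2 + x y + x^2 t / 2): the mean of this weight stays of
   order exp(- x^2 / 2) along the path, so the error is relative to the tail.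
   A shift of x by V^-3 and a smoothing variance V^-8, with V a small power of
   n, give back the indicator of the event. *)

(** * Real-valued expectation and covariance *)

Section expectation.
Context {d : measure_display} {T : measurableType d} {R : realType}.
Variable P : probability T R.
Implicit Types f g h : T -> R.

(** The obstacle is that an additive error of Berry-Esseen type is useless here: the tail 1 -
    Phi(x_n) may be as small as about n^(-lambda/2), so every error has to be a negative power of n
    times the tail itself. Clamping at n^(1/2 - eps) costs n E|X_1|^q n^(-q (1/2 - eps)), which is
    of order n^(-(q-2)/4) once eps q = (q-2)/4; assumption (i), read as lambda/2 < (q-2)/4, says
    exactly that this is negligible against the tail. For the replacement errors, the weight is the
    exponential tilt of large deviation theory: its mean is a product of moment generating
    functions, because Newman's argument also covers exponentials of bounded sums, and every
    derivative of the heat flow is below the weight up to powers of V. Since |x_n| grows at most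
    like sqrt(log n), a small power V = n^kap dominates 1 + |x_n| and all constants. The shift V^-3
    amounts to V standard deviations of the smoothing, which has standard deviation V^-4; this is
    why the indicator is recovered up to exp(- V^2 / 2). *)

Definition itg f := P.-integrable [set: T] (EFin \o f).
Definition Ex f : R := \int[P]_w f w.

Lemma itg_cst c : itg (fun=> c).
Proof. exact: finite_measure_integrable_cst. Qed.

Lemma itgD f g : itg f -> itg g -> itg (fun w => f w + g w).
Proof. by move=> fi gi; exact: (integrableD measurableT fi gi). Qed.

Lemma itgB f g : itg f -> itg g -> itg (fun w => f w - g w).
Proof. by move=> fi gi; exact: (integrableB measurableT fi gi). Qed.

Lemma itgZ c f : itg f -> itg (fun w => c * f w).
Proof. by move=> fi; exact: (integrableZl measurableT c fi). Qed.

Lemma itg_dom f g : measurable_fun [set: T] f -> itg g ->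
  (forall w, `|f w| <= g w) -> itg f.
Proof.
move=> mf gi fg; apply: le_integrable gi => //; first exact/measurable_EFinP.
move=> w _ /=; rewrite lee_fin; apply: (le_trans (fg w)); exact: ler_norm.
Qed.

Lemma itg_abs f : itg f -> itg (fun w => `|f w|).
Proof. by move=> fi; exact: (integrable_norm fi). Qed.

Lemma itg_bounded M f : measurable_fun [set: T] f ->
  (forall w, `|f w| <= M) -> itg f.
Proof. by move=> mf; apply: itg_dom => //; exact: itg_cst. Qed.

Lemma itg_sum (n : nat) (F : nat -> T -> R) :
  (forall i, itg (F i)) -> itg (fun w => \sum_(i < n) F i w).
Proof.
move=> Fi; elim: n => [|n IHn].
  by under eq_fun do rewrite big_ord0; exact: itg_cst.
by under eq_fun do rewrite big_ord_recr /=; exact: itgD.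
Qed.

Lemma Ex_cst c : Ex (fun=> c) = c.
Proof. by rewrite /Ex Rintegral_cst//= probability_setT mulr1. Qed.

Lemma ExD f g : itg f -> itg g -> Ex (fun w => f w + g w) = Ex f + Ex g.
Proof. exact: RintegralD. Qed.

Lemma ExB f g : itg f -> itg g -> Ex (fun w => f w - g w) = Ex f - Ex g.
Proof. exact: RintegralB. Qed.

Lemma ExZ c f : itg f -> Ex (fun w => c * f w) = c * Ex f.
Proof. exact: RintegralZl. Qed.

Lemma Ex_sum (n : nat) (F : nat -> T -> R) : (forall i, itg (F i)) ->
  Ex (fun w => \sum_(i < n) F i w) = \sum_(i < n) Ex (F i).
Proof.
move=> Fi; elim: n => [|n IHn].
  by rewrite big_ord0; under [X in Ex X]eq_fun do rewrite big_ord0; rewrite Ex_cst.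
under [X in Ex X]eq_fun do rewrite big_ord_recr /=.
by rewrite big_ord_recr/= ExD ?IHn//; exact: itg_sum.
Qed.

Lemma Ex_le f g : itg f -> itg g -> (forall w, f w <= g w) -> Ex f <= Ex g.
Proof. by move=> fi gi fg; exact: le_Rintegral. Qed.

Lemma Ex_ge0 f : (forall w, 0 <= f w) -> 0 <= Ex f.
Proof. by move=> f0; exact: Rintegral_ge0. Qed.

Lemma Ex_abs_le f g : itg f -> itg g -> (forall w, `|f w| <= g w) ->
  `|Ex f| <= Ex g.
Proof.
move=> fi gi fg; apply: (le_trans (le_normr_Rintegral measurableT fi)).
by apply: Ex_le => //; exact: itg_abs.
Qed.

Lemma Ex_indic (A : set T) : measurable A -> Ex (\1_A) = fine (P A).
Proof. by move=> mA; rewrite /Ex /Rintegral integral_indic// setIT. Qed.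

Lemma itg_indic (A : set T) : measurable A -> itg (\1_A).
Proof.
move=> mA; apply: (@itg_bounded 1); first exact: measurable_indic.
by move=> w; rewrite indicE; case: (_ \in _); rewrite ?normr1 ?normr0.
Qed.

Lemma fine_expectation f : fine 'E_P[f] = Ex f.
Proof. by rewrite unlock. Qed.

(** Measurability of [f] is required apart, since that of its square does not give it. *)
Definition sqi f := measurable_fun [set: T] f /\ itg (fun w => f w ^+ 2).

Lemma sqiM f g : sqi f -> sqi g -> itg (fun w => f w * g w).
Proof.
move=> [mf fi] [mg gi]; apply: (@itg_dom _ (fun w => f w ^+ 2 + g w ^+ 2)).
- exact: measurable_funM.
- exact: itgD.
- by move=> w; rewrite ler_norml; apply/andP; split; nra.
Qed.

Lemma sqi_cst c : sqi (fun=> c).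
Proof. by split => //; exact: itg_cst. Qed.

Lemma sqi_itg f : sqi f -> itg f.
Proof.
move=> fs; have := sqiM fs (sqi_cst 1).
by under eq_fun do rewrite mulr1.
Qed.

Lemma sqiD f g : sqi f -> sqi g -> sqi (fun w => f w + g w).
Proof.
move=> fs gs; split; first by apply: measurable_funD; [case: fs|case: gs].
apply: (@itg_dom _ (fun w => 2 * f w ^+ 2 + 2 * g w ^+ 2)).
- by apply: measurable_funX; apply: measurable_funD; [case: fs|case: gs].
- by apply: itgD; apply: itgZ; [case: fs|case: gs].
- by move=> w; rewrite ger0_norm ?sqr_ge0//; have := sqr_ge0 (f w - g w); nra.
Qed.

Lemma sqiZ c f : sqi f -> sqi (fun w => c * f w).
Proof.
move=> [mf fi]; split; first exact: measurable_funM.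
by under eq_fun do rewrite exprMn; exact: itgZ.
Qed.

Lemma sqi_bounded M f : measurable_fun [set: T] f ->
  (forall w, `|f w| <= M) -> sqi f.
Proof.
move=> mf fM; split => //; apply: (@itg_bounded (M ^+ 2)).
  exact: measurable_funX.
by move=> w; rewrite normrX lerXn2r// nnegrE; apply: le_trans (fM w).
Qed.

Lemma sqi_sum (n : nat) (F : nat -> T -> R) :
  (forall i, sqi (F i)) -> sqi (fun w => \sum_(i < n) F i w).
Proof.
move=> Fi; elim: n => [|n IHn].
  by under eq_fun do rewrite big_ord0; exact: sqi_cst.
by under eq_fun do rewrite big_ord_recr /=; exact: sqiD.
Qed.

Definition cv f g := Ex (fun w => f w * g w) - Ex f * Ex g.

Lemma fine_covariance f g : sqi f -> sqi g -> fine (covariance P f g) = cv f g.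
Proof.
move=> fs gs.
have [[fi gi] fgi] := (sqi_itg fs, sqi_itg gs, sqiM fs gs).
rewrite unlock fine_expectation !fine_expectation.
have -> : ((f \- cst (Ex f)) * (g \- cst (Ex g)))%R =
   (fun w => (f w * g w - Ex g * f w) - (Ex f * g w - Ex f * Ex g)).
  by apply/funext => w; rewrite !fctE/=; ring.
have fgf : itg (fun w => f w * g w - Ex g * f w) by apply: itgB => //; exact: itgZ.
have gc : itg (fun w => Ex f * g w - Ex f * Ex g).
  by apply: itgB; [exact: itgZ|exact: itg_cst].
rewrite (ExB fgf gc) (ExB fgi (itgZ _ fi)) (ExB (itgZ _ gi) (itg_cst _)).
by rewrite Ex_cst !ExZ// /cv; ring.
Qed.

Lemma cvDl f g h : sqi f -> sqi g -> sqi h ->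
  cv (fun w => f w + g w) h = cv f h + cv g h.
Proof.
move=> fs gs hs; rewrite /cv ExD; do ?exact: sqi_itg.
under [X in Ex X]eq_fun do rewrite mulrDl.
by rewrite ExD; [ring|exact: sqiM|exact: sqiM].
Qed.

Lemma cvC f g : cv f g = cv g f.
Proof.
rewrite /cv [X in _ - X]mulrC; congr (Ex _ - _).
by apply/funext => w; rewrite mulrC.
Qed.

Lemma cvDr f g h : sqi f -> sqi g -> sqi h ->
  cv h (fun w => f w + g w) = cv h f + cv h g.
Proof. by move=> *; rewrite cvC cvDl// !(cvC h). Qed.

Lemma cvZl c f g : sqi f -> sqi g -> cv (fun w => c * f w) g = c * cv f g.
Proof.
move=> fs gs; rewrite /cv ExZ; last exact: sqi_itg.
under [X in Ex X]eq_fun do rewrite -mulrA.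
by rewrite ExZ; [ring|exact: sqiM].
Qed.

Lemma cvZr c f g : sqi f -> sqi g -> cv f (fun w => c * g w) = c * cv f g.
Proof. by move=> *; rewrite cvC cvZl// cvC. Qed.

Lemma cv_suml (n : nat) (F : nat -> T -> R) g : (forall i, sqi (F i)) -> sqi g ->
  cv (fun w => \sum_(i < n) F i w) g = \sum_(i < n) cv (F i) g.
Proof.
move=> Fs gs; elim: n => [|n IHn].
  rewrite big_ord0 /cv; under [X in Ex X * _]eq_fun do rewrite big_ord0.
  under [X in Ex X - _]eq_fun do rewrite big_ord0 mul0r.
  by rewrite !Ex_cst mul0r subrr.
under [X in cv X]eq_fun do rewrite big_ord_recr /=.
by rewrite cvDl// ?big_ord_recr/= ?IHn//; exact: sqi_sum.
Qed.

End expectation.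

(** * Stationarity: equal laws of single variables and of pairs *)

Section stationarity.
Context {d : measure_display} {T : measurableType d} {R : realType}.
Variable P : probability T R.

(** Integrability is assumed for [Z] only: the change of variables for nonnegative functions,
    applied to |g|, carries it over to [Y], and then the signed one applies. *)
Lemma eq_law_Ex d' (T' : measurableType d') (Y Z : {RV P >-> T'})
    (g : T' -> R) : measurable_fun [set: T'] g ->
  (forall A, measurable A -> P (Y @^-1` A) = P (Z @^-1` A)) ->
  itg P (g \o Z) -> itg P (g \o Y) /\ Ex P (g \o Y) = Ex P (g \o Z).
Proof.
move=> mg YZ Zi.
have mg' : measurable_fun [set: T'] (EFin \o g) by exact/measurable_EFinP.
have YZl A : measurable A -> A `<=` setT -> distribution P Y A = distribution P Z A.
  by move=> mA _; exact: YZ.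
have YZint (f : T' -> \bar R) : (\int[distribution P Y]_y f y = \int[distribution P Z]_y f y)%E.
  exact: eq_measure_integral YZl.
have Yi : itg P (g \o Y).
  apply/integrableP; split.
    by apply/measurable_EFinP; exact: measurableT_comp.
  have /integrableP[_] := Zi; apply: le_lt_trans.
  have ma : measurable_fun [set: T'] (fun y => `|(g y)%:E|%E).
    by apply: measurableT_comp.
  have := @ge0_integral_distribution _ _ _ _ _ P Y _ ma (fun=> abse_ge0 _).
  have := @ge0_integral_distribution _ _ _ _ _ P Z _ ma (fun=> abse_ge0 _).
  by rewrite YZint => -> /= <-.
split => //; rewrite /Ex /Rintegral; congr fine.
have := @integral_distribution _ _ _ _ _ P Y _ mg' Yi.
have := @integral_distribution _ _ _ _ _ P Z _ mg' Zi.
by rewrite YZint => -> /= <-.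
Qed.

Variable X : nat -> {RV P >-> R}.
Hypothesis Xst : strictly_stationary P (fun n => X n).

Lemma stationary_Ex (m : nat) (g : R -> R) : measurable_fun [set: R] g ->
  itg P (g \o X 0) -> itg P (g \o X m) /\ Ex P (g \o X m) = Ex P (g \o X 0).
Proof.
move=> mg; apply: eq_law_Ex => // A mA.
have := Xst (k := 1) m (fun=> mA).
have -> k : [set w | forall i : 'I_1, A (X (k + i)%N w)] = X k @^-1` A.
  apply/seteqP; split => w /=; first by move=> /(_ ord0); rewrite addn0.
  by move=> Aw i; rewrite ord1 addn0.
have -> // : [set w | forall i : 'I_1, A (X (nat_of_ord i) w)] = X 0 @^-1` A.
by apply/seteqP; split => w /=; [move=> /(_ ord0)|move=> Aw i; rewrite ord1].
Qed.

(** Stationarity speaks of rectangles only; these form a generating system stable under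
    intersection, so both pairs have the same law on the plane. The coordinates strictly between 0
    and j + 1 are left free. *)
Lemma stationary_Ex2 (m j : nat) (g : R * R -> R) : measurable_fun setT g ->
  itg P (fun w => g (X 0 w, X j.+1 w)) ->
  Ex P (fun w => g (X m w, X (m + j.+1)%N w)) = Ex P (fun w => g (X 0 w, X j.+1 w)).
Proof.
move=> mg gi.
have mp a b : measurable_fun [set: T] (fun w => (X a w, X b w)).
  exact: measurable_fun_pair.
pose Y a b : {RV P >-> (R * R)%type} :=
  HB.pack (fun w => (X a w, X b w)) (isMeasurableFun.Build _ _ _ _ _ (mp a b)).
have [] := @eq_law_Ex _ _ (Y m (m + j.+1)%N) (Y 0%N j.+1) g mg _ gi => // A mA.
pose G : set (set (R * R)) := [set A `*` B | A in measurable & B in measurable].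
apply: (measure_unique G (fun=> setT) _ _ _ _
  (distribution P (Y m (m + j.+1)%N)) (distribution P (Y 0%N j.+1))) => //.
- exact: measurable_prod_measurableType.
- move=> _ _ [A1 mA1 [B1 mB1 <-]] [A2 mA2 [B2 mB2 <-]].
  by rewrite -setXI; exists (A1 `&` A2); [exact: measurableI|
    exists (B1 `&` B2) => //; exact: measurableI].
- by move=> _; exists setT => //; exists setT => //; rewrite setXTT.
- by rewrite bigcup_const//; exists 0%N.
- move=> _ [A1 mA1 [B1 mB1 <-]].
  pose B (i : 'I_j.+2) := if val i == 0%N then A1 else if val i == j.+1 then B1 else setT.
  have mB i : measurable (B i).
    by rewrite /B; case: ifP => // _; case: ifP.
  have h a : [set w | forall i : 'I_j.+2, B i (X (a + i)%N w)] =
      Y a (a + j.+1)%N @^-1` (A1 `*` B1).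
    apply/seteqP; split => w /=.
      move=> Bw; split => /=.
        by have := Bw ord0; rewrite /B/= addn0.
      by have := Bw ord_max; rewrite /B/= eqxx.
    move=> [/= wA wB] i; rewrite /B; case: eqP => [->|_]; first by rewrite addn0.
    by case: eqP => [->|].
  have := Xst (k := j.+2) m mB; rewrite h => hm.
  by apply: (etrans hm); exact: (congr1 P (h 0%N)).
- by move=> _; rewrite (le_lt_trans (probability_le1 _ _)) ?ltry.
Qed.

End stationarity.

(** Restricted to a ball because exponentials, squares and the heat kernel are used on bounded sums
    only, where local Lipschitz constants are enough. *)
Definition lip_on {R : realType} (M A : R) (f : R -> R) :=
  forall u v, `|u| <= M -> `|v| <= M -> `|f u - f v| <= A * `|u - v|.

(** * Newman's argument for truncated associated variables *)

Section newman.
Context {d : measure_display} {T : measurableType d} {R : realType}.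
Variables (P : probability T R) (X : nat -> {RV P >-> R}).
Hypothesis Xassoc : associated P (fun n => X n).
Hypothesis Xsq : forall n, sqi P (X n).
Hypothesis Xuncor : forall i j, (i < j)%N -> cv P (X i) (X j) = 0.
Variables (c : R -> R) (b l : R).
Hypothesis c_incr : forall u v, u <= v -> 0 <= c v - c u <= l * (v - u).
Hypothesis c_le : forall u, `|c u| <= b.

Definition tsum (k : nat) : T -> R := fun w => \sum_(i < k) c (X i w).

Lemma c_nd : {homo c : u v / u <= v}.
Proof. by move=> u v /c_incr/andP[+ _]; rewrite subr_ge0. Qed.

Lemma cX_measurable i : measurable_fun [set: T] (fun w => c (X i w)).
Proof.
have mc : measurable_fun [set: R] c.
  by apply: nondecreasing_measurable => //; exact: c_nd.
exact: measurableT_comp mc _.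
Qed.

Lemma tsum_measurable k : measurable_fun [set: T] (tsum k).
Proof. by apply: measurable_sum => i; exact: cX_measurable. Qed.

Lemma tsumS k w : tsum k.+1 w = tsum k w + c (X k w).
Proof. by rewrite /tsum big_ord_recr. Qed.

Lemma tsum_le k w : `|tsum k w| <= k%:R * b.
Proof.
apply: (le_trans (ler_norm_sum _ _ _)).
apply: (le_trans (ler_sum _ (fun i _ => c_le _))).
by rewrite sumr_const card_ord mulr_natl.
Qed.

Lemma lip_on_bounded M A f (u : R) : 0 <= M -> 0 <= A -> lip_on M A f -> `|u| <= M ->
  `|f u| <= `|f 0| + A * M.
Proof.
move=> M0 A0 fl uM.
rewrite -[f u](subrK (f 0)) addrC; apply: (le_trans (ler_normD _ _)).
rewrite lerD2l; apply: (le_trans (fl _ _ _ _)); rewrite ?normr0// subr0.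
exact: ler_wpM2l.
Qed.

Lemma b_ge0 : 0 <= b.
Proof. exact: le_trans (normr_ge0 _) (c_le 0). Qed.

(** Since [c] is nondecreasing and [l]-Lipschitz, the variation of [f (tsum k)] is at most that of A
    l (X_0 + ... + X_(k-1)), and likewise for [g]. Association then bounds the covariance by one
    between the dominating sums, which vanishes. *)
Lemma tsum_indep k (f g : R -> R) A B :
  measurable_fun [set: R] f -> measurable_fun [set: R] g ->
  0 <= A -> 0 <= B -> lip_on (k%:R * b) A f -> lip_on b B g ->
  Ex P (fun w => f (tsum k w) * g (c (X k w))) =
  Ex P (fun w => f (tsum k w)) * Ex P (fun w => g (c (X k w))).
Proof.
move=> mf mg A0 B0 fl gl.
have l0 : 0 <= l.
  by have /c_incr/andP[h1 h2] := @ler01 R; rewrite subr0 mulr1 in h2; exact: le_trans h2.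
have kb0 : 0 <= k%:R * b by rewrite mulr_ge0// b_ge0.
have fs : sqi P (fun w => f (tsum k w)).
  apply: sqi_bounded; first by apply: measurableT_comp mf (tsum_measurable k).
  by move=> w; apply: lip_on_bounded fl _ => //; exact: tsum_le.
have gs : sqi P (fun w => g (c (X k w))).
  apply: sqi_bounded; first by apply: measurableT_comp mg (cX_measurable k).
  by move=> w; apply: lip_on_bounded gl _ => //; exact: b_ge0.
pose S w := \sum_(i < k) X i w.
have Ss : sqi P S by exact: (@sqi_sum _ _ _ P k (fun i => X i)).
have SX : cv P S (X k) = 0.
  rewrite (@cv_suml _ _ _ P k (fun i => X i))//.
  by rewrite big1// => i _; exact: Xuncor.
(* Newman's trick: both combinations below are nondecreasing in the
   coordinates for either choice of the signs. *)
have key (s t : R) : `|s| = 1 -> `|t| = 1 ->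
    0 <= cv P (fun w => A * l * S w + s * f (tsum k w))
              (fun w => B * l * X k w + t * g (c (X k w))).
  move=> s1 t1.
  pose F (u : 'I_k.+1 -> R) := A * l * \sum_(i < k) u (widen_ord (leqnSn k) i) +
     s * f (\sum_(i < k) c (u (widen_ord (leqnSn k) i))).
  pose G (u : 'I_k.+1 -> R) := B * l * u ord_max + t * g (c (u ord_max)).
  have Fnd : coord_nondecreasing F.
    move=> u v uv; rewrite /F -subr_ge0.
    set U := \sum_(i < k) c (u _); set V := \sum_(i < k) c (v _).
    set U' := \sum_(i < k) (u _); set V' := \sum_(i < k) (v _).
    have UVle : `|V - U| <= l * (V' - U').
      rewrite /U /V /U' /V' -!sumrB mulr_sumr.
      apply: (le_trans (ler_norm_sum _ _ _)); apply: ler_sum => i _.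
      have /andP[h1 h2] := c_incr (uv (widen_ord (leqnSn k) i)).
      by rewrite ger0_norm.
    have sb (z : 'I_k.+1 -> R) : `|\sum_(i < k) c (z (widen_ord (leqnSn k) i))| <= k%:R * b.
      apply: (le_trans (ler_norm_sum _ _ _)).
      apply: (le_trans (ler_sum _ (fun i _ => c_le _))).
      by rewrite sumr_const card_ord mulr_natl.
    have h1 := fl _ _ (sb v) (sb u).
    have h2 : `|s * (f V - f U)| <= A * (l * (V' - U')).
      by rewrite normrM s1 mul1r (le_trans h1)// ler_wpM2l.
    move: h2; rewrite ler_norml => /andP[h2 _]; nra.
  have Gnd : coord_nondecreasing G.
    move=> u v uv; rewrite /G -subr_ge0.
    have /andP[h1 h2] := c_incr (uv ord_max).
    have h3 := gl _ _ (c_le (v ord_max)) (c_le (u ord_max)).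
    have h4 : `|t * (g (c (v ord_max)) - g (c (u ord_max)))| <= B * (l * (v ord_max - u ord_max)).
      by rewrite normrM t1 mul1r (le_trans h3)// ler_wpM2l// ger0_norm.
    move: h4; rewrite ler_norml => /andP[h4 _]; nra.
  have Fs : sqi P (fun w => A * l * S w + s * f (tsum k w)).
    by apply: sqiD; exact: sqiZ.
  have Gs : sqi P (fun w => B * l * X k w + t * g (c (X k w))).
    by apply: sqiD; exact: sqiZ.
  have := Xassoc Fnd Gnd (sqi_itg Fs) (sqi_itg Gs) (sqiM Fs Gs).
  move=> /fine_ge0; rewrite fine_covariance//.
have cvE (s t : R) : cv P (fun w => A * l * S w + s * f (tsum k w))
              (fun w => B * l * X k w + t * g (c (X k w))) =
   A * l * t * cv P S (fun w => g (c (X k w))) +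
   s * (B * l) * cv P (fun w => f (tsum k w)) (X k) +
   s * t * cv P (fun w => f (tsum k w)) (fun w => g (c (X k w))).
  rewrite cvDl; do ?[exact: sqiZ|by apply: sqiD; exact: sqiZ].
  rewrite !cvDr; do ?[exact: sqiZ].
  rewrite !cvZl//; do ?[exact: sqiZ].
  by rewrite !cvZr// SX; ring.
have N1 : `|(-1 : R)| = 1 by rewrite normrN1.
have := key _ _ (normr1 R) (normr1 R); have := key _ _ N1 N1.
have := key _ _ (normr1 R) N1; have := key _ _ N1 (normr1 R).
rewrite !cvE => k1 k2 k3 k4.
(* The two inequalities with equal signs add up to 2 cv >= 0, the two with opposite signs to - 2 cv
   >= 0; the mixed terms cancel within each pair. *)
have : cv P (fun w => f (tsum k w)) (fun w => g (c (X k w))) = 0 by lra.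
by rewrite /cv => /eqP; rewrite subr_eq0 => /eqP.
Qed.

End newman.

Lemma powR_cvg0n {R : realType} (a : R) : 0 < a ->
  (fun n : nat => n%:R `^ (- a)) @ \oo --> (0 : R).
Proof.
move=> a0; apply/cvgrPdist_le => /= e e0; near=> n.
have n0 : 0 < n%:R :> R by rewrite ltr0n; near: n; exact: nbhs_infty_gt.
rewrite sub0r normrN ger0_norm ?powR_ge0//.
have en : e `^ (- a^-1) <= n%:R by near: n; exact: nbhs_infty_ger.
have -> : e = (e `^ (- a^-1)) `^ (- a).
  by rewrite -powRrM mulrNN mulVf ?gt_eqF// powRr1// ltW.
rewrite !(powRN _ a) lef_pV2 ?posrE ?powR_gt0//.
by apply: ge0_ler_powR; rewrite ?nnegrE ?powR_ge0// ltW.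
Unshelve. all: by end_near. Qed.

(** * Variances of the partial sums under a fast rate *)

Section covariances.
Context {d : measure_display} {T : measurableType d} {R : realType}.
Variables (P : probability T R) (X : nat -> {RV P >-> R}).
Hypothesis Xst : strictly_stationary P (fun n => X n).
Hypothesis X0 : forall n, ('E_P[X n] = 0)%E.
Hypothesis Xsq : forall n, P.-integrable [set: T] (EFin \o (fun w => X n w ^+ 2)).
Hypothesis Xassoc : associated P (fun n => X n).
Hypothesis Xsum : cvgn (series (fun j => cov_seq P (fun n => X n) j.+1)).

Let Ssn n : sqi P (X n).
Proof. by split => //; exact: Xsq. Qed.

Let Ex0 n : Ex P (X n) = 0.
Proof. by rewrite -fine_expectation X0. Qed.

Let c j := cov_seq P (fun n => X n) j.+1.

Lemma cov_seqE m j : cv P (X m) (X (m + j.+1)%N) = c j.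
Proof.
rewrite /c /cov_seq fine_covariance// /cv !Ex0 !mul0r !subr0.
apply: (stationary_Ex2 Xst m (g := fun z => z.1 * z.2)).
  exact: measurable_funM.
exact: (sqiM (Ssn 0) (Ssn j.+1)).
Qed.

Lemma cov_seq_ge0 j : 0 <= c j.
Proof.
rewrite /c /cov_seq fine_ge0//.
have cn (i : 'I_j.+2) : coord_nondecreasing (fun u : 'I_j.+2 -> R => u i).
  by move=> u v; exact.
by apply: (Xassoc (cn ord0) (cn ord_max));
  [exact: sqi_itg|exact: sqi_itg|exact: sqiM].
Qed.

Lemma sn_sqrE n : sn P (fun n => X n) n ^+ 2 =
  Ex P (fun w => (\sum_(i < n) X i w) ^+ 2).
Proof.
rewrite /sn sqr_sqrtr; first exact: fine_expectation.
by apply: fine_ge0; apply: expectation_ge0 => w; exact: sqr_ge0.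
Qed.

(** The cross term E[S_n X_n] collects the covariances by lag; reversing the index turns the pair
    (i, n) into the lag n - i, so lags 1 to n appear once each. *)
Lemma sn_sqrS n : sn P (fun n => X n) n.+1 ^+ 2 =
  sn P (fun n => X n) n ^+ 2 + Ex P (fun w => X 0 w ^+ 2) + 2 * series c n.
Proof.
have Ss : sqi P (fun w => \sum_(i < n) X i w) by exact: (sqi_sum n (fun i => Ssn i)).
have ms : measurable_fun [set: R] (fun x : R => x ^+ 2) by exact: measurable_funX.
have <- : Ex P (fun w => X n w ^+ 2) = Ex P (fun w => X 0 w ^+ 2).
  by have [_] := stationary_Ex Xst n ms (Xsq 0).
have <- : Ex P (fun w => (\sum_(i < n) X i w) * X n w) = series c n.
  transitivity (cv P (fun w => \sum_(i < n) X i w) (X n)).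
    by rewrite /cv Ex0 mulr0 subr0.
  rewrite (cv_suml n (fun i => Ssn i))// /series/= big_mkord.
  rewrite (reindex_inj rev_ord_inj)/=; apply: eq_bigr => i _.
  rewrite -(cov_seqE (n - i.+1)); congr (cv P (X _) (X _)).
  by rewrite subnK.
rewrite !sn_sqrE -ExD; [|exact: (Ss.2)|exact: Xsq].
rewrite -ExZ; last exact: sqiM.
rewrite -ExD; last 2 first.
  by apply: itgD; [exact: (Ss.2)|exact: Xsq].
  by apply: itgZ; exact: sqiM.
by congr Ex; apply/funext => w; rewrite big_ord_recr/=; ring.
Qed.

(* A decay faster than 1/n in (A2) is incompatible with any correlation:
   [n sigma^2 - s_n^2] is nondecreasing and its first term is twice the sum
   of the covariances. *)
Lemma uncorrelated_of_rate (theta : R) : 0 < sigma2 P (fun n => X n) -> 1 < theta ->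
  (exists C : R, \forall n \near \oo,
     `|sn P (fun n => X n) n ^+ 2 / (n%:R * sigma2 P (fun n => X n)) - 1|
       <= C * (n%:R `^ (- theta))) ->
  [/\ forall i j, (i < j)%N -> cv P (X i) (X j) = 0,
      sigma2 P (fun n => X n) = Ex P (fun w => X 0 w ^+ 2) &
      forall n, sn P (fun n => X n) n ^+ 2 = n%:R * Ex P (fun w => X 0 w ^+ 2)].
Proof.
set s2 := sigma2 _ _; move=> s0 th1 [C Cn].
set L := limn (series c).
have s2E : s2 = Ex P (fun w => X 0 w ^+ 2) + 2 * L.
  by rewrite /s2 /sigma2 fine_expectation.
have cnd : nondecreasing_seq (series c).
  by apply: nondecreasing_series => n _ _; exact: cov_seq_ge0.
have serL n : series c n <= L by exact: nondecreasing_cvgn_le.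
have ser0 n : 0 <= series c n.
  by rewrite /series/= sumr_ge0// => i _; exact: cov_seq_ge0.
have Dn n : 2 * L <= n.+1%:R * s2 - sn P (fun n => X n) n.+1 ^+ 2.
  elim: n => [|n IHn].
    rewrite sn_sqrS sn_sqrE; under [X in Ex P X + _]eq_fun do rewrite big_ord0 expr0n/=.
    by rewrite Ex_cst /series/= big_geq// s2E; lra.
  rewrite sn_sqrS; have := serL n.+1; rewrite -natr1 mulrDl mul1r; lra.
have L0 : L = 0.
  apply/eqP; rewrite eq_le (le_trans (ser0 0) (serL 0)) andbT leNgt; apply/negP => Lp.
  have th : 0 < theta - 1 by rewrite subr_gt0.
  (* If L > 0, the rate bounds n sigma^2 - s_n^2 by C sigma^2 n^(1 - theta), which falls below 2 L.
     Taking |C| + 1 keeps the denominator positive whatever the sign of C. *)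
  have /cvgrPdist_lt/(_ (2 * L / (s2 * (`|C| + 1)))) := powR_cvg0n th.
  have den : 0 < s2 * (`|C| + 1) by rewrite mulr_gt0// ltr_pwDr.
  move=> /(_ _)[|n0 _ n0P]; first by rewrite divr_gt0// mulr_gt0.
  have [n1 _ n1P] := Cn.
  pose n := (maxn n0 n1).
  have := n0P n.+1; have := n1P n.+1.
  move=> /(_ (leqW (leq_maxr _ _))) h1 /(_ (leqW (leq_maxl _ _))) h2.
  rewrite sub0r normrN ger0_norm ?powR_ge0// in h2.
  have nn : 0 < n.+1%:R :> R by rewrite ltr0n.
  have pw : n.+1%:R `^ (- theta) * n.+1%:R = n.+1%:R `^ (- (theta - 1)).
    by rewrite -{2}(@powRr1 _ n.+1%:R) ?ltW// -powRD ?(gt_eqF nn) ?implybT//; congr (_ `^ _); ring.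
  have h3 : n.+1%:R * s2 - sn P (fun n => X n) n.+1 ^+ 2 <=
      C * n.+1%:R `^ (- theta) * (n.+1%:R * s2).
    rewrite -ler_pdivrMr ?mulr_gt0// mulrBl divff ?mulf_neq0 ?gt_eqF//.
    by rewrite (le_trans _ h1)// ler_normr; apply/orP; right; rewrite opprB.
  have h4 : C * n.+1%:R `^ (- theta) * (n.+1%:R * s2) =
      C * s2 * n.+1%:R `^ (- (theta - 1)) by rewrite -pw; ring.
  have h5 : C * s2 * n.+1%:R `^ (- (theta - 1)) <= s2 * (`|C| + 1) * n.+1%:R `^ (- (theta - 1)).
    rewrite ler_wpM2r ?powR_ge0// mulrC ler_pM2l//.
    by rewrite (le_trans (ler_norm C))// lerDl.
  rewrite ltr_pdivlMr// mulrC in h2.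
  have := Dn n; lra.
have c0 j : c j = 0.
  apply/eqP; rewrite eq_le cov_seq_ge0 andbT.
  have := serL j.+1; rewrite L0 seriesSr; have := ser0 j; lra.
split.
- move=> i j ij; rewrite -(subnKC ij) addSnnS cov_seqE; exact: c0.
- by rewrite s2E L0 mulr0 addr0.
- elim=> [|n IHn].
    rewrite sn_sqrE; under [X in Ex P X]eq_fun do rewrite big_ord0 expr0n/=.
    by rewrite Ex_cst mul0r.
  rewrite sn_sqrS IHn /series/= big1 => [|i _]; last exact: c0.
  by rewrite mulr0 addr0 -natr1 mulrDl mul1r.
Qed.

End covariances.

(** * Mean value inequalities *)

Section mean_value.
Context {R : realType}.
Implicit Types f df : R -> R.

Lemma mvt_le f df (a b : R) : a <= b ->
  (forall x, a <= x <= b -> is_derive x 1 f (df x)) ->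
  exists2 c, a <= c <= b & f b - f a = df c * (b - a).
Proof.
move=> ab fd; have [|c|c] := @MVT_segment R f df a b ab; last by exists c.
  by move=> x; rewrite in_itv/= => /andP[ax xb]; apply: fd; rewrite !ltW.
by apply: derivable_within_continuous => x; rewrite in_itv/= => /fd[].
Qed.

Lemma mvt_abs f df (a b : R) : (forall x : R, is_derive x 1 f (df x)) ->
  exists2 c, `|c - a| <= `|b - a| & f b - f a = df c * (b - a).
Proof.
move=> fd; have [ab|/ltW ba] := leP a b.
  have [c /andP[ac cb] fE] := mvt_le ab (fun x _ => fd x); exists c => //.
  by rewrite !ger0_norm ?subr_ge0// lerD2r.
have [c /andP[ac cb] fE] := mvt_le ba (fun x _ => fd x); exists c.
  by rewrite !ler0_norm ?subr_le0// lerN2 lerD2r.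
by rewrite -opprB fE; ring.
Qed.

Lemma derive_le0_le f df (a b : R) : a <= b ->
  (forall x, a <= x <= b -> is_derive x 1 f (df x)) ->
  (forall x, a <= x <= b -> df x <= 0) -> f b <= f a.
Proof.
move=> ab fd f0; have [c cab fE] := mvt_le ab fd; have := f0 _ cab; nra.
Qed.

End mean_value.

(** * Gaussian density and tail *)

Section gaussian.
Context {R : realType}.
Implicit Types x y z : R.

Definition gpdf : R -> R := normal_pdf 0 1.
Definition gtail x : R := 1 - Phi x.

Lemma gpdfE x : gpdf x = normal_peak 1 * expR (- (x ^+ 2 / 2)).
Proof.
rewrite /gpdf normal_pdfE ?oner_neq0// /normal_fun subr0 expr1n.
by congr (_ * expR _); rewrite mulNr.
Qed.

Lemma gpdf_gt0 x : 0 < gpdf x.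
Proof. by rewrite gpdfE mulr_gt0 ?expR_gt0// normal_peak_gt0 ?oner_neq0. Qed.

Lemma normal_peak1_gt0 : 0 < normal_peak 1 :> R.
Proof. exact: normal_peak_gt0 (oner_neq0 _). Qed.

Lemma normal_peak1_le1 : normal_peak 1 <= 1 :> R.
Proof.
rewrite /normal_peak expr1n mul1r invf_le1; last first.
  by rewrite sqrtr_gt0 mulrn_wgt0// pi_gt0.
rewrite -[leLHS]sqrtr1 ler_sqrt; last by rewrite mulrn_wge0// pi_ge0.
have := pi_ge2 R; rewrite -mulr_natr; lra.
Qed.

Lemma gpdf_le x : gpdf x <= expR (- (x ^+ 2 / 2)).
Proof. by rewrite gpdfE ler_piMl ?expR_ge0// normal_peak1_le1. Qed.

Lemma is_derive_gpdf x : is_derive x 1 gpdf (- x * gpdf x).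
Proof.
rewrite gpdfE; have -> : gpdf = (fun x => normal_peak 1 * expR (- (x ^+ 2 / 2))).
  by apply/funext => y; exact: gpdfE.
apply: is_derive_eq.
by rewrite /GRing.scale/=; field.
Qed.

Lemma is_derive_Phi x : is_derive x 1 Phi (gpdf x).
Proof.
have xx : x < x + 1 by rewrite ltrDl.
have gi : lebesgue_measure.-integrable [set` Interval -oo%O (BRight (x + 1))] (EFin \o gpdf).
  by apply: integrableS (integrable_normal_pdf 0 1).
have gc : {for x, continuous gpdf} by apply: continuous_normal_pdf; exact: oner_neq0.
have := continuous_FTC1 xx gi.
move=> /(_ _ gc)[|d1 d2]; first by rewrite ltNyr.
by apply: DeriveDef; [exact: d1|rewrite -derive1E; exact: d2].
Qed.

Lemma is_derive_gtail x : is_derive x 1 gtail (- gpdf x).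
Proof.
have Pd := is_derive_Phi x.
have : is_derive x 1 (cst 1 - (Phi : R -> R)) (- gpdf x).
  by apply: is_derive_eq; rewrite add0r.
by [].
Qed.

(** The identity, seen as a random variable under the normal law, has [Phi] as its distribution
    function; the limits of distribution functions thus apply to [Phi]. *)
Let idR : measurableTypeR R -> R := idfun.
#[local] HB.instance Definition _ :=
  @isMeasurableFun.Build _ _ _ _ idR (@measurable_id _ _ setT).

Lemma Phi_cvg1 : Phi x @[x --> +oo] --> (1 : R).
Proof. exact: (fine_cvg (cvg_cdfy1 (idR : {RV (normal_prob 0 1) >-> R}))). Qed.

Lemma Phi_cvg0 : Phi x @[x --> -oo] --> (0 : R).
Proof. exact: (fine_cvg (cvg_cdfNy0 (idR : {RV (normal_prob 0 1) >-> R}))). Qed.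

Lemma gtail_ge0 x : 0 <= gtail x.
Proof.
rewrite subr_ge0 -lee_fin /Phi fineK; last exact: fin_num_measure.
exact: probability_le1.
Qed.

Lemma gtail_le1 x : gtail x <= 1.
Proof. by rewrite /gtail gerBl /Phi fine_ge0. Qed.

Lemma gtail_nincr x y : x <= y -> gtail y <= gtail x.
Proof.
move=> xy; apply: derive_le0_le xy (fun z _ => is_derive_gtail z) _ => z _.
by rewrite oppr_le0 ltW// gpdf_gt0.
Qed.

Lemma gtail_small (e M : R) : 0 < e -> exists2 z, M <= z & gtail z <= e.
Proof.
move=> e0; have /cvgrPdist_le/(_ _ e0)[z0 [_ z0P]] := Phi_cvg1.
exists (Num.max M (z0 + 1)); first by rewrite le_max lexx.
have := z0P (Num.max M (z0 + 1)); rewrite lt_max ltrDl ltr01 orbT.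
by move=> /(_ isT); rewrite -/(gtail _) ger0_norm// gtail_ge0.
Qed.

Lemma Phi_small (e M : R) : 0 < e -> exists2 z, z <= M & Phi z <= e.
Proof.
move=> e0; have /cvgrPdist_le/(_ _ e0)[z0 [_ z0P]] := Phi_cvg0.
exists (Num.min M (z0 - 1)); first by rewrite ge_min lexx.
have := z0P (Num.min M (z0 - 1)); rewrite gt_min ltrBlDr ltrDl ltr01 orbT.
by move=> /(_ isT); rewrite sub0r normrN; apply: le_trans; exact: ler_norm.
Qed.

(** The difference [gpdf - gtail] has derivative (1 - y) [gpdf y], nonpositive from 1 on, and is
    above - e at a far point. *)
Lemma gtail_le x : 1 <= x -> gtail x <= expR (- (x ^+ 2 / 2)).
Proof.
move=> x1; apply: le_trans (gpdf_le x); apply/ler_addgt0Pr => e e0.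
have [z xz ze] := gtail_small x e0.
have d y : is_derive y 1 (gpdf - gtail) (- y * gpdf y - - gpdf y).
  by apply: is_deriveB; [exact: is_derive_gpdf|exact: is_derive_gtail].
have : (gpdf - gtail) z <= (gpdf - gtail) x.
  apply: derive_le0_le xz (fun y _ => d y) _ => y /andP[xy _].
  have := gpdf_gt0 y; nra.
rewrite !fctE; have := gpdf_gt0 z; lra.
Qed.

Lemma gtailN_ge x : 1 <= x -> 1 - expR (- (x ^+ 2 / 2)) <= gtail (- x).
Proof.
move=> x1; rewrite /gtail lerB//; have := gpdf_le (- x); rewrite sqrrN.
apply: le_trans; apply/ler_addgt0Pr => e e0.
have [z xz ze] := Phi_small (- x) e0.
have d y : is_derive y 1 (Phi - gpdf) (gpdf y - - y * gpdf y).
  by apply: is_deriveB; [exact: is_derive_Phi|exact: is_derive_gpdf].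
have : (Phi - gpdf) (- x) - (Phi - gpdf) z <= 0.
  have [c /andP[_ cx] ->] := mvt_le xz (fun y _ => d y).
  by apply: mulr_le0_ge0; rewrite ?subr_ge0//; have := gpdf_gt0 c; nra.
rewrite !fctE; have := gpdf_gt0 z; lra.
Qed.

(** Lower Mills ratio. On u >= 0 the function [gtail u] - [gpdf u] / (1 + u) has derivative - u
    [gpdf u] / (1 + u)^2, and it is almost nonnegative far away. A negative x reduces to 0, where
    [gpdf] is largest. *)
Lemma gpdf_le_gtail x : gpdf x <= (1 + `|x|) * gtail x.
Proof.
have pos z : 0 <= z -> gpdf z <= (1 + z) * gtail z.
  move=> z0; rewrite mulrC -ler_pdivrMr ?ltr_pwDl//.
  apply/ler_addgt0Pr => e e0; rewrite -lerBlDr.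
  (* Beyond 1 / e, the term [gpdf y] / (1 + y) is at most 1 / (1 + y) <= e. *)
  set y := Num.max z e^-1.
  have zy : z <= y by rewrite le_max lexx.
  have ey : e^-1 <= y by rewrite le_max lexx orbT.
  have y0 : 0 < y by rewrite (lt_le_trans _ ey)// invr_gt0.
  pose f := gtail - (gpdf * (fun u => (1 + u)^-1)).
  pose df u := - gpdf u - ((- u * gpdf u) * (1 + u)^-1 - gpdf u * (1 + u) ^- 2).
  have fd u : z <= u <= y -> is_derive u 1 f (df u).
    move=> /andP[zu _]; have u1 : 1 + u != 0 by rewrite gt_eqF// ltr_pwDl// (le_trans z0).
    have d1 := is_derive_gtail u; have d2 := is_derive_gpdf u.
    have d3 : is_derive u 1 (fun u => (1 + u)^-1) (- (1 + u) ^- 2).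
      have d4 : is_derive u 1 (fun u : R => 1 + u) 1.
        have := is_deriveD (is_derive_cst (1 : R) u 1) (is_derive_id u 1).
        by rewrite add0r.
      have := @is_deriveV R (fun u => 1 + u) u 1 1 u1 d4.
      by rewrite /GRing.scale/= mulr1.
    apply: is_derive_eq; rewrite /df /GRing.scale/=; ring.
  have df0 u : z <= u <= y -> df u <= 0.
    move=> /andP[zu _]; have u1 : 0 < 1 + u by rewrite ltr_pwDl// (le_trans z0).
    have -> : df u = - (u * (1 + u) ^- 2 * gpdf u).
      by rewrite /df; field; rewrite gt_eqF.
    rewrite oppr_le0; apply: mulr_ge0; last by rewrite ltW// gpdf_gt0.
    by apply: mulr_ge0; [exact: le_trans zu|rewrite invr_ge0 exprn_ge0// ltW].
  have := derive_le0_le zy fd df0; rewrite /f !fctE.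
  have : gpdf y * (1 + y)^-1 <= e.
    have y1 : 0 < 1 + y by rewrite addr_gt0.
    rewrite ler_pdivrMr//.
    apply: (@le_trans _ _ 1).
      apply: le_trans (gpdf_le y) _; rewrite -expR0 ler_expR oppr_le0.
      by rewrite mulr_ge0// sqr_ge0.
    have : e * e^-1 <= e * y by rewrite ler_pM2l.
    by rewrite mulfV ?gt_eqF// mulrDr mulr1; have := e0; lra.
  have := gtail_ge0 y; lra.
have [x0|/ltW x0] := leP 0 x; first by rewrite ger0_norm//; exact: pos.
rewrite ler0_norm//; apply: le_trans (_ : gtail 0 <= _); last first.
  apply: le_trans (gtail_nincr x0) _; rewrite ler_peMl ?gtail_ge0//.
  by rewrite lerDl oppr_ge0.
apply: le_trans (_ : gpdf 0 <= _); last by have := pos 0 (lexx _); rewrite addr0 mul1r.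
rewrite !gpdfE ler_pM2l ?normal_peak1_gt0// ler_expR expr0n/= mul0r oppr0.
by rewrite oppr_le0 mulr_ge0// sqr_ge0.
Qed.

Lemma gtail_gt0 x : 0 < gtail x.
Proof.
have := gpdf_le_gtail x; have := gpdf_gt0 x; have := gtail_ge0 x.
have : 0 < 1 + `|x| by rewrite ltr_pwDl.
nra.
Qed.

(** The ratio of the densities is exp(x (x - y) - (x - y)^2 / 2), and the square is dropped. *)
Lemma gpdf_shift x y : gpdf y <= gpdf x * expR (`|x| * `|x - y|).
Proof.
rewrite !gpdfE -(mulrA (normal_peak 1)) ler_pM2l ?normal_peak1_gt0// -expRD ler_expR.
rewrite -normrM; have := ler_norm (x * (x - y)); have := sqr_ge0 (x - y); nra.
Qed.

(** A relative bound: the density met along the way is turned back into [gtail x] by the Mills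
    ratio, so that a small shift becomes a multiplicative error. *)
Lemma gtail_lipschitz x y :
  `|gtail y - gtail x| <= `|x - y| * expR (`|x| * `|x - y|) * ((1 + `|x|) * gtail x).
Proof.
have [c cx ->] := mvt_abs x y is_derive_gtail.
rewrite normrM normrN (ger0_norm (ltW (gpdf_gt0 c))) (distrC y) mulrC -[leRHS]mulrA.
apply: ler_wpM2l => //; apply: le_trans (gpdf_shift x c) _; rewrite mulrC.
apply: ler_pM; [exact: expR_ge0|exact/ltW/gpdf_gt0| |exact: gpdf_le_gtail].
by rewrite ler_expR ler_wpM2l// distrC (le_trans cx)// distrC.
Qed.

End gaussian.

Section taylor.
Context {R : realType}.

(** Three nested mean value steps on the successive remainders [g1] and [g0]; the factor 1/6 is
    given up. *)
Lemma taylor2_bound (f0 f1 f2 f3 : R -> R) (y z M : R) :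
  (forall v : R, is_derive v 1 f0 (f1 v)) ->
  (forall v : R, is_derive v 1 f1 (f2 v)) ->
  (forall v : R, is_derive v 1 f2 (f3 v)) ->
  (forall v, `|v - y| <= `|z| -> `|f3 v| <= M) ->
  `|f0 (y + z) - f0 y - f1 y * z - f2 y * (z ^+ 2 / 2)| <= M * `|z| ^+ 3.
Proof.
move=> d0 d1 d2 f3M.
have M0 : 0 <= M by apply: le_trans (f3M y _); rewrite ?subrr ?normr0.
have s2 v : `|v - y| <= `|z| -> `|f2 v - f2 y| <= M * `|z|.
  move=> vz; have [c cy ->] := mvt_abs y v d2.
  by rewrite normrM ler_pM// f3M// (le_trans cy).
pose g1 := f1 - cst (f1 y) - f2 y \*: (id - cst y).
have dg1 (v : R) : is_derive v 1 g1 (f2 v - f2 y).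
  have := d1 v => d1v; apply: is_derive_eq.
  by rewrite !subr0 /GRing.scale/= mulr1.
have s1 v : `|v - y| <= `|z| -> `|g1 v| <= M * `|z| ^+ 2.
  move=> vz; have [c cy] := mvt_abs y v dg1.
  have -> : g1 v - g1 y = g1 v.
    by rewrite /g1 !fctE/= /GRing.scale/=; ring.
  move=> ->; rewrite normrM expr2 mulrA ler_pM// s2// (le_trans cy)//.
pose g0 := f0 - cst (f0 y) - f1 y \*: (id - cst y) - (f2 y / 2) \*: (id - cst y) ^+ 2.
have dg0 (v : R) : is_derive v 1 g0 (g1 v).
  have := d0 v => d0v; apply: is_derive_eq.
  by rewrite /g1 !fctE/= /GRing.scale/= !subr0 ?expr1 ?mulr1; field.
have [c cy] := mvt_abs y (y + z) dg0.
have yz : y + z - y = z by ring.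
have -> : g0 (y + z) - g0 y = f0 (y + z) - f0 y - f1 y * z - f2 y * (z ^+ 2 / 2).
  by rewrite /g0 !fctE/= /GRing.scale/=; field.
rewrite yz in cy *; move=> ->; rewrite normrM exprSr mulrA ler_pM// s1//.
Qed.

End taylor.

(** * The heat flow issued from the indicator of y > x *)

Section heat.
Context {R : realType}.
Variable x : R.

(** [W0 t y] is the probability that y plus a centered Gaussian of variance t exceeds x. Its first
    derivative in y is [heat], those of orders two to four are [W2], [W3], [W4]. By the heat
    equation, a derivative in t is half of the derivative two orders higher in y. *)
Definition heat (t y : R) : R :=
  normal_peak 1 * (Num.sqrt t)^-1 * expR (- ((x - y) ^+ 2 / (2 * t))).
Definition W0 (t y : R) : R := gtail ((x - y) / Num.sqrt t).
Definition W2 (t y : R) : R := (x - y) / t * heat t y.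
Definition W3 (t y : R) : R := ((x - y) ^+ 2 / t ^+ 2 - t^-1) * heat t y.
Definition W4 (t y : R) : R :=
  ((x - y) ^+ 3 / t ^+ 3 - 3 * (x - y) / t ^+ 2) * heat t y.

Lemma heatE t y : 0 < t ->
  heat t y = (Num.sqrt t)^-1 * gpdf ((x - y) / Num.sqrt t).
Proof.
move=> t0; rewrite gpdfE /heat mulrCA mulrA.
congr (_ * expR (- _)); rewrite exprMn exprVn sqr_sqrtr ?ltW//; field.
by rewrite gt_eqF.
Qed.

Lemma is_derive_lin_comp (f : R -> R) (a b y df : R) :
  is_derive (a * y + b) 1 f df -> is_derive y 1 (fun u => f (a * u + b)) (a * df).
Proof.
move=> fd.
have ld : is_derive y 1 (fun u => a * u + b) a.
  have := is_deriveD (is_deriveZ a (is_derive_id y 1)) (is_derive_cst b y 1).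
  by rewrite addr0 /GRing.scale/= mulr1.
have := @is_derive1_comp R f (fun u => a * u + b) y df a fd ld.
by rewrite mulrC.
Qed.

Section yderiv.
Variables (t : R) (t0 : 0 < t).

Lemma is_derive_heat (y : R) : is_derive y 1 (heat t) (W2 t y).
Proof.
pose q := (Num.sqrt t)^-1.
have q2 : q ^+ 2 = t^-1 by rewrite exprVn sqr_sqrtr// ltW.
have -> : heat t = (fun y => q * gpdf ((- q) * y + q * x)).
  by apply/funext => u; rewrite heatE//; congr (_ * gpdf _); rewrite -/q; ring.
have := is_derive_lin_comp (is_derive_gpdf (- q * y + q * x)).
set df := - q * _ => dd.
apply: is_derive_eq; rewrite /GRing.scale/= /df /W2 heatE// -q2 -/q.
have -> : (x - y) * q = - q * y + q * x by ring.
ring.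
Qed.

Lemma is_derive_W0 (y : R) : is_derive y 1 (W0 t) (heat t y).
Proof.
pose q := (Num.sqrt t)^-1.
have -> : W0 t = (fun y => gtail ((- q) * y + q * x)).
  by apply/funext => u; rewrite /W0; congr gtail; rewrite -/q; ring.
have := is_derive_lin_comp (is_derive_gtail (- q * y + q * x)).
rewrite mulrNN heatE// -/q.
by have -> : (x - y) * q = - q * y + q * x by ring.
Qed.

Lemma is_derive_xB (y : R) : is_derive y 1 (fun u => x - u) (-1).
Proof.
have := is_deriveB (is_derive_cst x y 1) (is_derive_id y 1).
by rewrite sub0r.
Qed.

Lemma is_derive_W2 (y : R) : is_derive y 1 (W2 t) (W3 t y).
Proof.
have d1 := is_derive_heat y; have d2 := is_derive_xB y.
have -> : W2 t = t^-1 \*: ((fun u => x - u) * heat t).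
  by apply/funext => u; rewrite /W2 !fctE/= /GRing.scale/=; ring.
apply: is_derive_eq; rewrite /W3 /W2 /GRing.scale/=; field.
by rewrite gt_eqF.
Qed.

End yderiv.

Lemma is_derive_sqrtV (t : R) : 0 < t ->
  is_derive t 1 (fun u => (Num.sqrt u)^-1) (- (2 * t)^-1 * (Num.sqrt t)^-1).
Proof.
move=> t0; have s0 : Num.sqrt t != 0 by rewrite gt_eqF// sqrtr_gt0.
have := is_deriveV s0 (is_derive1_sqrt t0).
rewrite /GRing.scale/= sqr_sqrtr ?ltW//.
congr is_derive; field; rewrite s0 gt_eqF//.
Qed.

Lemma is_derive_W0t (t y : R) : 0 < t ->
  is_derive t 1 (fun u => W0 u y) (W2 t y / 2).
Proof.
move=> t0; have d1 := is_derive_sqrtV t0.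
have d2 : is_derive t 1 (fun u => (x - y) / Num.sqrt u)
    ((x - y) * (- (2 * t)^-1 * (Num.sqrt t)^-1)).
  exact: (is_deriveZ (x - y) d1).
have := @is_derive1_comp R gtail (fun u => (x - y) / Num.sqrt u) t _ _
  (is_derive_gtail _) d2.
rewrite /W2 heatE// => h; apply: is_derive_eq h _.
field; rewrite !gt_eqF// sqrtr_gt0//.
Qed.

Lemma is_derive_heatt (t y : R) : 0 < t ->
  is_derive t 1 (fun u => heat u y) (W3 t y / 2).
Proof.
move=> t0; have d1 := is_derive_sqrtV t0.
have tn : t != 0 by rewrite gt_eqF.
have d2 : is_derive t 1 (fun u => - ((x - y) ^+ 2 / (2 * u)))
    ((x - y) ^+ 2 / (2 * t ^+ 2)).
  have := is_deriveZ (- ((x - y) ^+ 2 / 2)) (is_deriveV tn (is_derive_id t 1)).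
  rewrite /GRing.scale/= => h.
  have -> : (fun u => - ((x - y) ^+ 2 / (2 * u))) =
     (- ((x - y) ^+ 2 / 2)) \*: (fun u => u^-1).
    by apply/funext => u; rewrite /= /GRing.scale/= invfM; ring.
  by apply: is_derive_eq h _; field.
have d3 := @is_derive1_comp R expR (fun u => - ((x - y) ^+ 2 / (2 * u))) t _ _
  (is_derive_expR _) d2.
have -> : (fun u => heat u y) = normal_peak 1 \*: ((fun u => (Num.sqrt u)^-1) *
   (expR \o (fun u => - ((x - y) ^+ 2 / (2 * u))))).
  by apply/funext => u; rewrite /heat !fctE/= /GRing.scale/=; ring.
apply: is_derive_eq; rewrite /W3 /heat !fctE /GRing.scale/=; field.
by rewrite tn gt_eqF// sqrtr_gt0.
Qed.

Lemma is_derive_W2t (t y : R) : 0 < t ->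
  is_derive t 1 (fun u => W2 u y) (W4 t y / 2).
Proof.
move=> t0; have d1 := is_derive_heatt y t0.
have tn : t != 0 by rewrite gt_eqF.
have d2 := is_deriveV tn (is_derive_id t 1).
have -> : (fun u => W2 u y) = (x - y) \*: ((fun u => u^-1) * (fun u => heat u y)).
  by apply/funext => u; rewrite /W2 !fctE/= /GRing.scale/=; ring.
apply: is_derive_eq; rewrite /W4 /W3 /GRing.scale/= ?/GRing.scale/=; field.
exact: tn.
Qed.

End heat.

(** * Derivatives of the heat flow against the exponential weight *)

Section heat_bounds.
Context {R : realType}.
Variable x : R.

(** With r = x - y - x t, the exponent -(x - y)^2 / (2 t) equals - r^2 / (2 t) plus the exponent of
    [wgt], which is thus its tangent in y at r = 0. Being exponential in y, the weight has a mean
    that factors along the sums. *)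
Definition wgt (t y : R) : R := expR (- x ^+ 2 + x * y + x ^+ 2 * t / 2).
(** U^-1 is the least standard deviation allowed: U^7 comes from t^(-1/2) in [heat] and t^-3 in
    [W4]. The number 512 is 64 from [cube_expR] times 2^3 from 1 + |x - y| <= 2 (1 + |x|) (1 +
    |r|). *)
Definition dconst (U : R) : R := 512 * (1 + `|x|) ^+ 3 * U ^+ 7.

Lemma dconst_ge0 (U : R) : 0 <= U -> 0 <= dconst U.
Proof.
move=> U0; apply: mulr_ge0; last exact: exprn_ge0.
by apply: mulr_ge0; [exact: ler0n|apply: exprn_ge0; apply: addr_ge0].
Qed.

(** Cube of 1 + |r| <= 4 exp(r^2 / 12), which follows from exp z >= 1 + z. *)
Lemma cube_expR (r : R) : (1 + `|r|) ^+ 3 * expR (- (r ^+ 2 / 4)) <= 64.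
Proof.
have h : 1 + `|r| <= 4 * expR (r ^+ 2 / 12).
  have := expR_ge1Dx (r ^+ 2 / 12); rewrite -(real_normK (num_real r)).
  have := sqr_ge0 (`|r| - 3 / 2); lra.
have -> : r ^+ 2 / 4 = 3 * (r ^+ 2 / 12) by field.
rewrite -mulrN expRM_natl -exprMn.
have -> : (64 : R) = 4 ^+ 3 by ring.
rewrite lerXn2r ?nnegrE ?mulr_ge0 ?expR_ge0// expRN.
by rewrite ler_pdivrMr ?expR_gt0.
Qed.

(** Once the weight is split off, the factor exp(- r^2 / (2 t)) remains; as t <= 2 it is at most
    exp(- r^2 / 4) and absorbs the polynomial in r. *)
Lemma heat_le (U t y : R) : 1 <= U -> U ^- 2 <= t -> t <= 2 ->
  (1 + `|x - y|) ^+ 3 * heat x t y <= 512 * (1 + `|x|) ^+ 3 * U * wgt t y.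
Proof.
move=> U1 Ut t2.
have U0 : 0 < U by exact: lt_le_trans U1.
have t0 : 0 < t by apply: lt_le_trans Ut; rewrite invr_gt0 exprn_gt0.
have st : (Num.sqrt t)^-1 <= U.
  rewrite invf_ple ?posrE ?sqrtr_gt0// -(ger0_norm (ltW U0)) -normfV -sqrtr_sqr.
  by rewrite ler_wsqrtr// exprVn.
set s := x - y; pose r := s - x * t.
have -> : heat x t y = normal_peak 1 * (Num.sqrt t)^-1 *
    (expR (- (r ^+ 2 / (2 * t))) * wgt t y).
  rewrite /heat /wgt -expRD; congr (_ * expR _).
  by rewrite /r /s; field; rewrite gt_eqF.
have s_le : 1 + `|s| <= (1 + `|r|) * (2 * (1 + `|x|)).
  have -> : s = r + x * t by rewrite /r subrK.
  have := ler_normD r (x * t); rewrite normrM (gtr0_norm t0).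
  have := normr_ge0 r; have := normr_ge0 x; nra.
have s3 : (1 + `|s|) ^+ 3 <= (1 + `|r|) ^+ 3 * (8 * (1 + `|x|) ^+ 3).
  have -> : (1 + `|r|) ^+ 3 * (8 * (1 + `|x|) ^+ 3) = ((1 + `|r|) * (2 * (1 + `|x|))) ^+ 3 by ring.
  by rewrite lerXn2r ?nnegrE ?mulr_ge0.
have er : expR (- (r ^+ 2 / (2 * t))) <= expR (- (r ^+ 2 / 4)).
  rewrite ler_expR lerN2 ler_wpM2l ?sqr_ge0// lef_pV2 ?posrE ?mulr_gt0//; lra.
have p1 : normal_peak 1 * (Num.sqrt t)^-1 <= U.
  rewrite -[leRHS]mul1r ler_pM ?normal_peak_ge0 ?invr_ge0 ?sqrtr_ge0//.
  exact: normal_peak1_le1.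
have c3 := cube_expR r.
have e0 := expR_ge0 (- (r ^+ 2 / (2 * t))).
have w0 : 0 <= wgt t y by exact: expR_ge0.
have L0 : 0 <= 8 * (1 + `|x|) ^+ 3 by rewrite mulr_ge0// exprn_ge0// addr_ge0.
have pk0 : 0 <= normal_peak 1 * (Num.sqrt t)^-1 :> R.
  by rewrite mulr_ge0 ?normal_peak_ge0 ?invr_ge0 ?sqrtr_ge0.
have main : (1 + `|s|) ^+ 3 * expR (- (r ^+ 2 / (2 * t))) <= 64 * (8 * (1 + `|x|) ^+ 3).
  apply: le_trans (_ : (1 + `|r|) ^+ 3 * (8 * (1 + `|x|) ^+ 3) * expR (- (r ^+ 2 / 4)) <= _).
    by rewrite ler_pM// exprn_ge0// addr_ge0.
  by rewrite mulrAC ler_wpM2r.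
have -> : (1 + `|s|) ^+ 3 * (normal_peak 1 * (Num.sqrt t)^-1 *
    (expR (- (r ^+ 2 / (2 * t))) * wgt t y)) =
  (1 + `|s|) ^+ 3 * expR (- (r ^+ 2 / (2 * t))) *
    (normal_peak 1 * (Num.sqrt t)^-1) * wgt t y by ring.
rewrite ler_wpM2r//.
have -> : 512 * (1 + `|x|) ^+ 3 * U = 64 * (8 * (1 + `|x|) ^+ 3) * U by ring.
by rewrite ler_pM// mulr_ge0// exprn_ge0// addr_ge0.
Qed.

Lemma heat_ge0 t y : 0 <= heat x t y.
Proof. by rewrite !mulr_ge0 ?normal_peak_ge0 ?invr_ge0 ?sqrtr_ge0 ?expR_ge0. Qed.

Lemma W_le (U t y : R) : 1 <= U -> U ^- 2 <= t -> t <= 2 ->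
  [/\ `|heat x t y| <= dconst U * wgt t y, `|W2 x t y| <= dconst U * wgt t y,
      `|W3 x t y| <= dconst U * wgt t y & `|W4 x t y| <= dconst U * wgt t y].
Proof.
move=> U1 Ut t2; have hl := heat_le y U1 Ut t2; have h0 := heat_ge0 t y.
have U0 : 0 < U by exact: lt_le_trans U1.
have t0 : 0 < t by apply: lt_le_trans Ut; rewrite invr_gt0 exprn_gt0.
pose v := t^-1.
have v0 : 0 < v by rewrite invr_gt0.
have vU : v <= U ^+ 2 by rewrite -[leRHS]invrK lef_pV2 ?posrE// invr_gt0 exprn_gt0.
have U2 : 1 <= U ^+ 2 by rewrite exprn_ege1.
have U20 : 0 <= U ^+ 2 by rewrite exprn_ge0// ltW.
have v0' := ltW v0.
have v2U : v ^+ 2 <= U ^+ 6.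
  apply: le_trans (_ : (U ^+ 2) ^+ 2 <= _); first by rewrite lerXn2r.
  by rewrite -exprM ler_weXn2l.
have v3U : v ^+ 3 <= U ^+ 6.
  by have -> : U ^+ 6 = (U ^+ 2) ^+ 3; [ring|rewrite lerXn2r].
have vU6 : v <= U ^+ 6 by apply: (le_trans vU); rewrite ler_weXn2l.
have oU6 : 1 <= U ^+ 6 by rewrite exprn_ege1.
set s := x - y in hl *; set a := `|s| in hl *.
have a0 : 0 <= a by exact: normr_ge0.
have a2 : 0 <= a ^+ 2 by rewrite exprn_ge0.
have a3 : 0 <= a ^+ 3 by rewrite exprn_ge0.
have a13 : (1 + a) ^+ 3 = 1 + 3 * a + 3 * a ^+ 2 + a ^+ 3 by ring.
(* Each derivative is [heat] times a polynomial in x - y and 1 / t, of degree at most three in each;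
   expanding (1 + a)^3 dominates its terms one by one. *)
have conc (C : R) : `|C| <= U ^+ 6 * (1 + a) ^+ 3 -> `|C * heat x t y| <= dconst U * wgt t y.
  move=> CU; rewrite normrM (ger0_norm h0).
  apply: le_trans (_ : U ^+ 6 * ((1 + a) ^+ 3 * heat x t y) <= _).
    by rewrite (mulrA (U ^+ 6)) ler_wpM2r.
  have -> : dconst U * wgt t y = U ^+ 6 * (512 * (1 + `|x|) ^+ 3 * U * wgt t y).
    by rewrite /dconst; ring.
  by rewrite ler_wpM2l// exprn_ge0// ltW.
have b1 : v * a <= U ^+ 6 * a by rewrite ler_wpM2r.
have b2 : v ^+ 2 * a <= U ^+ 6 * a by rewrite ler_wpM2r.
have b3 : v ^+ 2 * a ^+ 2 <= U ^+ 6 * a ^+ 2 by rewrite ler_wpM2r.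
have b4 : v ^+ 3 * a ^+ 3 <= U ^+ 6 * a ^+ 3 by rewrite ler_wpM2r.
have c1 : 0 <= U ^+ 6 * a by rewrite mulr_ge0// (le_trans _ oU6).
have c2 : 0 <= U ^+ 6 * a ^+ 2 by rewrite mulr_ge0// (le_trans _ oU6).
have c3 : 0 <= U ^+ 6 * a ^+ 3 by rewrite mulr_ge0// (le_trans _ oU6).
split.
- rewrite -[heat _ _ _]mul1r; apply: conc; rewrite normr1 a13; lra.
- apply: conc; rewrite normrM -/s -/a -/v (gtr0_norm v0) a13; lra.
- apply: conc; rewrite a13 -/v -exprVn -/v.
  apply: (le_trans (ler_normB _ _)).
  by rewrite normrM !normrX -/s -/a (gtr0_norm v0); lra.
- apply: conc; rewrite a13 -!exprVn -/v.
  apply: (le_trans (ler_normB _ _)).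
  rewrite normrM (normrM (3 * (x - y))) (normrM 3) !normrX -/s -/a (gtr0_norm v0).
  by rewrite (@gtr0_norm _ 3)//; lra.
Qed.

Lemma wgt_gt0 t y : 0 < wgt t y. Proof. exact: expR_gt0. Qed.

Lemma wgt_shift (t y u z : R) : `|u - y| <= `|z| -> `|x| * `|z| <= 1 ->
  wgt t u <= expR 1 * wgt t y.
Proof.
move=> uz xz; rewrite /wgt -expRD ler_expR.
have : x * (u - y) <= 1.
  apply: le_trans (ler_norm _) _; rewrite normrM; apply: le_trans xz.
  by rewrite ler_wpM2l.
lra.
Qed.

Lemma wgt_later (t t' y : R) : t <= t' -> x ^+ 2 * (t' - t) <= 2 ->
  wgt t' y <= expR 1 * wgt t y.
Proof. by move=> tt xt; rewrite /wgt -expRD ler_expR; lra. Qed.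

(** Adding z in space and adding h to the variance agree up to two explicit terms, whose means
    vanish when z is centered of variance h and independent of y. The cube is the Taylor remainder
    in y, the square of h the one in t. *)
Lemma lindeberg_step (U t h y z : R) : 1 <= U -> U ^- 2 <= t -> 0 <= h -> t + h <= 2 ->
  `|x| * `|z| <= 1 -> x ^+ 2 * h <= 2 ->
  `|W0 x t (y + z) - W0 x (t + h) y - (heat x t y * z + W2 x t y * ((z ^+ 2 - h) / 2))|
   <= expR 1 * dconst U * wgt t y * (`|z| ^+ 3 + h ^+ 2).
Proof.
move=> U1 Ut h0 th xz xh.
have U0 : 0 < U by exact: lt_le_trans U1.
have t0 : 0 < t by apply: lt_le_trans Ut; rewrite invr_gt0 exprn_gt0.
have D0 := dconst_ge0 (ltW U0).
have t2 : t <= 2 by lra.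
have Dw u t' : wgt t' u <= expR 1 * wgt t y ->
    dconst U * wgt t' u <= expR 1 * dconst U * wgt t y.
  by move=> h1; rewrite -mulrA mulrCA ler_wpM2l.
have sp : `|W0 x t (y + z) - W0 x t y - heat x t y * z - W2 x t y * (z ^+ 2 / 2)|
    <= expR 1 * dconst U * wgt t y * `|z| ^+ 3.
  apply: (taylor2_bound (is_derive_W0 x t0) (is_derive_heat x t0) (is_derive_W2 x t0)).
  move=> v vz; have [_ _ h3 _] := W_le v U1 Ut t2.
  by apply: (le_trans h3); apply: Dw; exact: wgt_shift vz xz.
have tp : `|W0 x (t + h) y - W0 x t y - W2 x t y * (h / 2)|
    <= expR 1 * dconst U * wgt t y * h ^+ 2.
  have tth : t <= t + h by rewrite lerDl.
  have pos u : t <= u <= t + h -> 0 < u by move=> /andP[tu _]; exact: lt_le_trans tu.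
  (* Two mean value steps in t: the first turns the increment of [W0] into [W2] at a time c, the
     second compares [W2] at c and at t through [W4]. *)
  have [c /andP[tc ch] ->] := mvt_le tth (fun u uP => is_derive_W0t x y (pos u uP)).
  have pos' u : t <= u <= c -> 0 < u by move=> /andP[tu _]; exact: lt_le_trans tu.
  have [c' /andP[tc' ch'] W2E] := mvt_le tc (fun u uP => is_derive_W2t x y (pos' u uP)).
  have -> : W2 x c y / 2 * (t + h - t) - W2 x t y * (h / 2) =
     W4 x c' y / 2 * (c - t) * (h / 2) by rewrite -W2E; field.
  have tc'2 : c' <= 2 by rewrite (le_trans ch')// (le_trans ch).
  have [_ _ _ h4] := W_le y U1 (le_trans Ut tc') tc'2.
  have hw : `|W4 x c' y| <= expR 1 * dconst U * wgt t y.
    apply: (le_trans h4); apply: Dw; apply: wgt_later => //.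
    apply: le_trans xh; rewrite ler_wpM2l ?sqr_ge0//; lra.
  have ct : 0 <= c - t <= h by lra.
  have -> : W4 x c' y / 2 * (c - t) * (h / 2) = W4 x c' y * ((c - t) * h / 4) by field.
  rewrite normrM ler_pM// ger0_norm; last by rewrite divr_ge0// mulr_ge0// ?(andP ct).1.
  by move: ct => /andP[? ?]; nra.
set A := W0 x t (y + z) in sp *; set B := W0 x t y in sp tp.
set C := W0 x (t + h) y in tp *.
have -> : A - C - (heat x t y * z + W2 x t y * ((z ^+ 2 - h) / 2)) =
  (A - B - heat x t y * z - W2 x t y * (z ^+ 2 / 2)) - (C - B - W2 x t y * (h / 2)).
  by field.
by rewrite (le_trans (ler_normB _ _))// mulrDr lerD.
Qed.

End heat_bounds.

Lemma lip_on_derive {R : realType} (M A : R) (f df : R -> R) :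
  (forall u : R, is_derive u 1 f (df u)) -> (forall u, `|u| <= M -> `|df u| <= A) ->
  lip_on M A f.
Proof.
move=> fd dfA u v uM vM; wlog uv : u v uM vM / u <= v.
  by move=> h; have [/h|/ltW/h] := leP u v; [exact|rewrite distrC (distrC u); exact].
have [c /andP[uc cv] fE] := mvt_le uv (fun w _ => fd w).
rewrite distrC fE normrM (distrC u) ler_wpM2r// dfA//.
by move: uM vM; rewrite !ler_norml; lra.
Qed.

(** * One replacement step in the mean *)

Section lindeberg.
Context {d : measure_display} {T : measurableType d} {R : realType}.
Variables (P : probability T R) (X : nat -> {RV P >-> R}).
Hypothesis Xst : strictly_stationary P (fun n => X n).
Hypothesis Xassoc : associated P (fun n => X n).
Hypothesis Xsq : forall n, sqi P (X n).
Hypothesis Xuncor : forall i j, (i < j)%N -> cv P (X i) (X j) = 0.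
Variables (c : R -> R) (b l : R).
Hypothesis c_incr : forall u v, u <= v -> 0 <= c v - c u <= l * (v - u).
Hypothesis c_le : forall u, `|c u| <= b.
Variable x : R.

Let m := Ex P (fun w => c (X 0 w)).
Let v := Ex P (fun w => c (X 0 w) ^+ 2).
Let mu := Ex P (fun w => expR (x * c (X 0 w))).
Let S := tsum X c.

Let indep (k : nat) (f g : R -> R) (A B : R) :
  measurable_fun [set: R] f -> measurable_fun [set: R] g ->
  0 <= A -> 0 <= B -> lip_on (k%:R * b) A f -> lip_on b B g ->
  Ex P (fun w => f (S k w) * g (c (X k w))) =
  Ex P (fun w => f (S k w)) * Ex P (fun w => g (c (X k w))).
Proof. exact: (tsum_indep Xassoc Xsq Xuncor c_incr c_le). Qed.

Let mc : measurable_fun [set: R] c.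
Proof. by apply: nondecreasing_measurable => //; exact: (c_nd c_incr). Qed.

Let b0 : 0 <= b. Proof. exact: b_ge0 c_le. Qed.

Lemma Ex_cX (g : R -> R) (M : R) k : measurable_fun [set: R] g ->
  (forall u, `|u| <= b -> `|g u| <= M) ->
  Ex P (fun w => g (c (X k w))) = Ex P (fun w => g (c (X 0 w))).
Proof.
move=> mg gM; have mgc : measurable_fun [set: R] (g \o c) by exact: measurableT_comp.
have [|//] := stationary_Ex Xst k mgc.
apply: (@itg_bounded _ _ _ P M); last by move=> w; exact: gM.
exact: measurableT_comp mgc _.
Qed.

Lemma is_derive_expRZ (u : R) : is_derive u 1 (fun u => expR (x * u)) (x * expR (x * u)).
Proof.
have := @is_derive_lin_comp R expR x 0 u _ (is_derive_expR _).
rewrite addr0; congr is_derive; apply/funext => y; by rewrite addr0.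
Qed.

Lemma derive_measurable (f df : R -> R) :
  (forall u : R, is_derive u 1 f (df u)) -> measurable_fun [set: R] f.
Proof.
move=> fd; apply: continuous_measurable_fun => u.
by apply/differentiable_continuous/derivable1_diffP; have [] := fd u.
Qed.

Let mexp : measurable_fun [set: R] (fun u => expR (x * u)).
Proof. exact: derive_measurable is_derive_expRZ. Qed.

Let exp_le (M u : R) : `|u| <= M -> expR (x * u) <= expR (`|x| * M).
Proof.
move=> uM; rewrite ler_expR (le_trans (ler_norm _))// normrM ler_wpM2l//.
Qed.

Let exp_lip (M : R) : lip_on M (`|x| * expR (`|x| * M)) (fun u => expR (x * u)).
Proof.
apply: lip_on_derive is_derive_expRZ _ => u uM.
by rewrite normrM (ger0_norm (expR_ge0 _)) ler_wpM2l// exp_le.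
Qed.

Lemma Ex_expR_tsum k : Ex P (fun w => expR (x * S k w)) = mu ^+ k.
Proof.
elim: k => [|k IHk].
  rewrite expr0 -(Ex_cst P 1); congr Ex; apply/funext => w.
  by rewrite /S /tsum big_ord0 mulr0 expR0.
rewrite exprSr -IHk -[mu](@Ex_cX (fun u => expR (x * u)) (expR (`|x| * b)) k)//; last first.
  by move=> u ub; rewrite ger0_norm ?expR_ge0// exp_le.
rewrite -(indep mexp mexp _ _ (@exp_lip _) (@exp_lip _)) ?mulr_ge0 ?expR_ge0//.
by congr Ex; apply/funext => w; rewrite /S tsumS mulrDr expRD.
Qed.

Lemma Ex_wgt t k : Ex P (fun w => wgt x t (S k w)) =
  expR (- x ^+ 2 + x ^+ 2 * t / 2) * mu ^+ k.
Proof.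
rewrite -Ex_expR_tsum -ExZ.
  by congr Ex; apply/funext => w; rewrite -expRD /wgt; congr expR; ring.
apply: (@itg_bounded _ _ _ P (expR (`|x| * (k%:R * b)))).
  exact: measurableT_comp mexp (tsum_measurable X c_incr k).
by move=> w; rewrite ger0_norm ?expR_ge0// exp_le// tsum_le.
Qed.

Let wgt_bound (M t u : R) : `|u| <= M -> wgt x t u <= expR (- x ^+ 2 + `|x| * M + x ^+ 2 * t / 2).
Proof.
move=> uM; rewrite ler_expR lerD2r lerD2l (le_trans (ler_norm _))// normrM ler_wpM2l//.
Qed.

(** Every term of the pointwise estimate is a function of [S k] times a function of the next
    variable, so its mean factors by [indep]. Truncation spoils the centering and the variance,
    hence the terms in m and v - h; the third moment is at most b v. *)
Lemma tsum_step (U t h : R) (k : nat) : 1 <= U -> U ^- 2 <= t -> 0 <= h -> t + h <= 2 ->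
  `|x| * b <= 1 -> x ^+ 2 * h <= 2 ->
  `|Ex P (fun w => W0 x t (S k.+1 w)) - Ex P (fun w => W0 x (t + h) (S k w))| <=
  expR 1 * dconst x U * (expR (- x ^+ 2 + x ^+ 2 * t / 2) * mu ^+ k) *
    (`|m| + `|v - h| + b * v + h ^+ 2).
Proof.
move=> U1 Ut h0 th xb xh.
have U0 : 0 < U by exact: lt_le_trans U1.
have t0 : 0 < t by apply: lt_le_trans Ut; rewrite invr_gt0 exprn_gt0.
have th0 : 0 < t + h by rewrite ltr_wpDr.
have t2 : t <= 2 by lra.
have D0 : 0 <= dconst x U by exact: dconst_ge0 (ltW U0).
rewrite -Ex_wgt.
pose M := k%:R * b.
(* A crude bound on the weight: it serves integrability and the Lipschitz constants, and is absent
   from the final estimate. *)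
pose G := expR (- x ^+ 2 + `|x| * M + x ^+ 2 * t / 2).
have SM w : `|S k w| <= M by exact: tsum_le.
have mS := tsum_measurable X c_incr k.
have mz := cX_measurable X c_incr k.
have wG w : `|wgt x t (S k w)| <= G by rewrite gtr0_norm ?wgt_gt0// wgt_bound.
have mW := derive_measurable (is_derive_heat x t0).
have mW2 := derive_measurable (is_derive_W2 x t0).
have mwgt : measurable_fun [set: R] (wgt x t).
  have -> : wgt x t = (fun u => expR (- x ^+ 2 + x ^+ 2 * t / 2) * expR (x * u)).
    by apply/funext => u; rewrite -expRD /wgt; congr expR; ring.
  exact: measurable_funM.
have Sb (f : R -> R) (A : R) : measurable_fun [set: R] f -> (forall u, `|u| <= M -> `|f u| <= A) ->
    sqi P (fun w => f (S k w)).
  move=> mf fA; apply: (@sqi_bounded _ _ _ P A); first exact: measurableT_comp mf mS.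
  by move=> w; exact: fA.
have zb (g : R -> R) (A : R) : measurable_fun [set: R] g -> (forall u, `|u| <= b -> `|g u| <= A) ->
    sqi P (fun w => g (c (X k w))).
  move=> mg gA; apply: (@sqi_bounded _ _ _ P A); first exact: measurableT_comp mg mz.
  by move=> w; exact: gA.
have Wb u : `|u| <= M -> [/\ `|heat x t u| <= dconst x U * G,
    `|W2 x t u| <= dconst x U * G & `|W3 x t u| <= dconst x U * G].
  move=> uM; have [h1 h2 h3 _] := W_le x u U1 Ut t2.
  by split; rewrite (le_trans _ (ler_wpM2l D0 (wgt_bound t uM))).
have DG0 : 0 <= dconst x U * G by rewrite mulr_ge0// expR_ge0.
have hS : sqi P (fun w => heat x t (S k w)) by apply: (Sb _ (dconst x U * G)) => // u /Wb[].
have W2S : sqi P (fun w => W2 x t (S k w)) by apply: (Sb _ (dconst x U * G)) => // u /Wb[].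
have wS : sqi P (fun w => wgt x t (S k w)).
  by apply: (Sb _ G) => // u uM; rewrite gtr0_norm ?wgt_gt0// wgt_bound.
have W0S s : 0 < s -> itg P (fun w => W0 x s (S k w)).
  move=> s0; apply: sqi_itg; apply: (Sb _ 1); first exact: derive_measurable (is_derive_W0 x s0).
  by move=> u _; rewrite ger0_norm ?gtail_ge0// gtail_le1.
have W0S2 := W0S (t + h) th0.
have W0S1 : itg P (fun w => W0 x t (S k w + c (X k w))).
  apply: (@itg_bounded _ _ _ P 1).
    apply: measurableT_comp; first exact: derive_measurable (is_derive_W0 x t0).
    exact: measurable_funD.
  by move=> w; rewrite ger0_norm ?gtail_ge0// gtail_le1.
have zS : sqi P (fun w => c (X k w)) by apply: (zb id b).
have msq : measurable_fun [set: R] (fun u : R => u ^+ 2) by exact: measurable_funX.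
have sqb u : `|u| <= b -> `|u ^+ 2| <= b ^+ 2 by move=> ub; rewrite normrX lerXn2r// nnegrE.
have z2S : sqi P (fun w => c (X k w) ^+ 2) by apply: (zb (fun u => u ^+ 2) (b ^+ 2)).
have id_lip : lip_on b 1 (id : R -> R) by move=> u u' _ _; rewrite mul1r.
have sq_lip : lip_on b (2 * b) (fun u : R => u ^+ 2).
  move=> u u' ub ub'; rewrite subr_sqr normrM mulrC ler_wpM2r//.
  by rewrite (le_trans (ler_normD _ _))// mulr_natl mulr2n lerD.
have mE : Ex P (fun w => c (X k w)) = m by exact: (@Ex_cX id b).
have vE : Ex P (fun w => c (X k w) ^+ 2) = v by exact: (@Ex_cX (fun u => u ^+ 2) (b ^+ 2)).
have heat_lip : lip_on M (dconst x U * G) (heat x t).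
  by apply: lip_on_derive (is_derive_heat x t0) _ => u /Wb[].
have W2_lip : lip_on M (dconst x U * G) (W2 x t).
  by apply: lip_on_derive (is_derive_W2 x t0) _ => u /Wb[].
have wgt_lip : lip_on M (expR (- x ^+ 2 + x ^+ 2 * t / 2) * (`|x| * expR (`|x| * M))) (wgt x t).
  have wE u : wgt x t u = expR (- x ^+ 2 + x ^+ 2 * t / 2) * expR (x * u).
    by rewrite -expRD /wgt; congr expR; ring.
  move=> u u' uM uM'; rewrite !wE -mulrBr normrM (ger0_norm (expR_ge0 _)) -[leRHS]mulrA.
  by rewrite ler_wpM2l ?expR_ge0// exp_lip.
have I1 : Ex P (fun w => heat x t (S k w) * c (X k w)) =
    Ex P (fun w => heat x t (S k w)) * m.
  by rewrite -mE; apply: (indep (g := id) mW _ DG0 ler01 heat_lip id_lip).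
have I2 : Ex P (fun w => W2 x t (S k w) * c (X k w) ^+ 2) =
    Ex P (fun w => W2 x t (S k w)) * v.
  by rewrite -vE; apply: (indep mW2 msq DG0 _ W2_lip sq_lip); rewrite mulr_ge0.
have I3 : Ex P (fun w => wgt x t (S k w) * c (X k w) ^+ 2) =
    Ex P (fun w => wgt x t (S k w)) * v.
  rewrite -vE; apply: (indep mwgt msq _ _ wgt_lip sq_lip); rewrite ?mulr_ge0 ?expR_ge0//.
set EW := Ex P (fun w => wgt x t (S k w)) in I3 *.
have EW0 : 0 <= EW by apply: Ex_ge0 => w; exact/ltW/wgt_gt0.
have v0 : 0 <= v by apply: Ex_ge0 => w; exact: sqr_ge0.
pose main w := heat x t (S k w) * c (X k w) + W2 x t (S k w) * ((c (X k w) ^+ 2 - h) / 2).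
have mainE w : main w = heat x t (S k w) * c (X k w) +
    (2^-1 * (W2 x t (S k w) * c (X k w) ^+ 2) + (- (h / 2)) * W2 x t (S k w)).
  by rewrite /main; field.
have i1 := sqiM hS zS; have i2 := sqiM W2S z2S; have i3 := sqi_itg W2S.
have i23 : itg P (fun w => 2^-1 * (W2 x t (S k w) * c (X k w) ^+ 2) + (- (h / 2)) * W2 x t (S k w)).
  by apply: itgD; exact: itgZ.
have maini : itg P main by rewrite (funext mainE); exact: itgD.
have Emain : Ex P main = Ex P (fun w => heat x t (S k w)) * m +
    Ex P (fun w => W2 x t (S k w)) * ((v - h) / 2).
  rewrite (funext mainE) (ExD i1 i23) (ExD (itgZ _ i2) (itgZ _ i3)).
  by rewrite (ExZ _ i2) (ExZ _ i3) I1 I2; field.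
pose rem w := W0 x t (S k w + c (X k w)) - W0 x (t + h) (S k w) - main w.
have remi : itg P rem by exact: (itgB (itgB W0S1 W0S2) maini).
pose dom w := expR 1 * dconst x U * (b * (wgt x t (S k w) * c (X k w) ^+ 2) +
   h ^+ 2 * wgt x t (S k w)).
have j1 := sqiM wS z2S; have j2 := sqi_itg wS.
have domi : itg P dom by apply: itgZ; apply: itgD; exact: itgZ.
have Edom : Ex P dom = expR 1 * dconst x U * EW * (b * v + h ^+ 2).
  rewrite /dom ExZ; last by apply: itgD; exact: itgZ.
  rewrite (ExD (itgZ _ j1) (itgZ _ j2)) (ExZ _ j1) (ExZ _ j2) I3 -/EW; ring.
have eD0 : 0 <= expR 1 * dconst x U by rewrite mulr_ge0// expR_ge0.
have hrem : `|Ex P rem| <= Ex P dom.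
  apply: Ex_abs_le => // w; rewrite /rem /main.
  have xz : `|x| * `|c (X k w)| <= 1 by rewrite (le_trans _ xb)// ler_wpM2l.
  apply: (le_trans (lindeberg_step (S k w) U1 Ut h0 th xz xh)).
  rewrite /dom -(mulrA (expR 1 * dconst x U)); apply: ler_wpM2l => //.
  have w0 := ltW (wgt_gt0 x t (S k w)).
  have : `|c (X k w)| ^+ 3 <= b * c (X k w) ^+ 2.
    by rewrite exprS -[in leRHS]real_normK ?num_real// ler_wpM2r// exprn_ge0.
  by move=> /(ler_wpM2l w0); lra.
have hheat : `|Ex P (fun w => heat x t (S k w))| <= dconst x U * EW.
  rewrite -ExZ//; apply: Ex_abs_le; [exact: sqi_itg|exact: itgZ|].
  by move=> w; have [] := W_le x (S k w) U1 Ut t2.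
have hW2 : `|Ex P (fun w => W2 x t (S k w))| <= dconst x U * EW.
  rewrite -ExZ//; apply: Ex_abs_le; [exact: sqi_itg|exact: itgZ|].
  by move=> w; have [] := W_le x (S k w) U1 Ut t2.
have -> : Ex P (fun w => W0 x t (S k.+1 w)) - Ex P (fun w => W0 x (t + h) (S k w)) =
    Ex P rem + Ex P main.
  rewrite -(ExD remi maini); under [X in Ex P X - _]eq_fun do rewrite /S tsumS.
  by rewrite -(ExB W0S1 W0S2); congr Ex; apply/funext => w; rewrite /rem subrK.
have DE0 : 0 <= dconst x U * EW by rewrite mulr_ge0.
have hmain : `|Ex P main| <= dconst x U * EW * (`|m| + `|v - h|).
  rewrite Emain (le_trans (ler_normD _ _))// mulrDr lerD// normrM.
    by rewrite ler_wpM2r.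
  rewrite ler_pM// normrM ler_piMr// ger0_norm//; lra.
rewrite (le_trans (ler_normD _ _))//.
have e1 : 1 <= expR 1 :> R by rewrite -expR0 ler_expR.
have q0 : 0 <= dconst x U * EW * (`|m| + `|v - h|) by rewrite mulr_ge0// addr_ge0.
have := ler_wpM2r q0 e1; rewrite mul1r => hq.
rewrite Edom in hrem.
have -> : expR 1 * dconst x U * EW * (`|m| + `|v - h| + b * v + h ^+ 2) =
  expR 1 * dconst x U * EW * (b * v + h ^+ 2) + expR 1 * (dconst x U * EW * (`|m| + `|v - h|)).
  by ring.
by rewrite lerD// (le_trans hmain).
Qed.

End lindeberg.

(** * Linear arithmetic on the exponents *)

Section exponent.
Context {R : realFieldType}.
Implicit Types h p q r u y : R.

Lemma time_split_le p q r u : p + q + r = 1 -> u <= 1 -> 0 <= p -> u + q + r <= 2.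
Proof. lra. Qed.

Lemma exponent_split h p y : p * (y * h / 2 + h) = (y / 2 + 1) * (p * h).
Proof. by field. Qed.

(** Here p, q and r are k/n, (n - k - 1)/n and 1/n, y is x^2 and u the smoothing variance. The
    constant 2 is 1 for y u / 2 plus 1 for the extra p. *)
Lemma exponent_split_le p q r u y :
  p + q + r = 1 -> 0 <= y * r -> 0 <= q -> 0 <= r -> y * u <= 2 ->
  - y + y * (u + q) / 2 + (y / 2 + 1) * p <= 2 + - y / 2.
Proof.
move=> pqr yr q0 r0 yu; have -> : p = 1 - q - r by lra.
lra.
Qed.

End exponent.

(** * Summing the replacements over the path *)

Section smooth.
Context {d : measure_display} {T : measurableType d} {R : realType}.
Variables (P : probability T R) (X : nat -> {RV P >-> R}).
Hypothesis Xst : strictly_stationary P (fun n => X n).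
Hypothesis Xassoc : associated P (fun n => X n).
Hypothesis Xsq : forall n, sqi P (X n).
Hypothesis Xuncor : forall i j, (i < j)%N -> cv P (X i) (X j) = 0.
Variables (c : R -> R) (b l : R).
Hypothesis c_incr : forall u v, u <= v -> 0 <= c v - c u <= l * (v - u).
Hypothesis c_le : forall u, `|c u| <= b.
Variable x : R.

Let m := Ex P (fun w => c (X 0 w)).
Let v := Ex P (fun w => c (X 0 w) ^+ 2).
Let mu := Ex P (fun w => expR (x * c (X 0 w))).
Let S := tsum X c.

Definition lerr (n : nat) : R := `|m| + `|v - n%:R^-1| + b * v + n%:R ^- 2.

Let b0 : 0 <= b. Proof. exact: b_ge0 c_le. Qed.

Let v0 : 0 <= v. Proof. by apply: Ex_ge0 => w; exact: sqr_ge0. Qed.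

Lemma lerr_ge0 n : 0 <= lerr n.
Proof. by rewrite !addr_ge0// ?mulr_ge0// invr_ge0 exprn_ge0. Qed.

(** Integrating exp(x u) <= 1 + x u + (x^2 / 2 + e |x|^3 b) u^2 gives the Gaussian value up to e (1
    + |x|)^3 [lerr n], which the hypothesis keeps below 1/n. Over n factors this excess costs only a
    factor e. *)
Lemma mgf_le n : (0 < n)%N -> `|x| * b <= 1 ->
  expR 1 * (1 + `|x|) ^+ 3 * (n%:R * lerr n) <= 1 ->
  mu <= expR (x ^+ 2 * n%:R^-1 / 2 + n%:R^-1).
Proof.
move=> n0 xb H; set h := n%:R^-1.
have h0 : 0 < h by rewrite invr_gt0 ltr0n.
have mz := cX_measurable X c_incr 0.
have zS : sqi P (fun w => c (X 0 w)) by apply: (@sqi_bounded _ _ _ P b).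
have z1 := sqi_itg zS; have [_ z2] := zS.
have step u : `|u| <= b -> expR (x * u) <= 1 + x * u + (x ^+ 2 / 2 + expR 1 * `|x| ^+ 3 * b) * u ^+ 2.
  move=> ub.
  have E0 (a y : R) : is_derive y 1 (fun u => a * expR (x * u)) (a * x * expR (x * y)).
    by have := is_deriveZ a (is_derive_expRZ x y); rewrite /GRing.scale/= mulrA.
  have E3 (y : R) : `|y - 0| <= `|u| -> `|1 * x * x * x * expR (x * y)| <= `|x| ^+ 3 * expR 1.
    rewrite subr0 => yu; rewrite mul1r !normrM -!expr2 -exprSr ler_wpM2l ?exprn_ge0//.
    rewrite ger0_norm ?expR_ge0// ler_expR (le_trans (ler_norm _))// normrM.
    by rewrite (le_trans _ xb)// ler_wpM2l// (le_trans yu).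
  have := taylor2_bound (E0 1) (E0 (1 * x)) (E0 (1 * x * x)) E3.
  rewrite !add0r !mulr0 !expR0 !mul1r !mulr1 ler_norml => /andP[_].
  have : `|u| ^+ 3 <= b * u ^+ 2.
    by rewrite exprS -[in leRHS]real_normK ?num_real// ler_wpM2r// exprn_ge0.
  move=> /(ler_wpM2l (mulr_ge0 (exprn_ge0 3 (normr_ge0 x)) (expR_ge0 1))).
  lra.
have muP : mu <= 1 + x * m + (x ^+ 2 / 2 + expR 1 * `|x| ^+ 3 * b) * v.
  set K := x ^+ 2 / 2 + expR 1 * `|x| ^+ 3 * b.
  have i1 : itg P (fun w => 1 + x * c (X 0 w)) by apply: itgD; [exact: itg_cst|exact: itgZ].
  rewrite -[X in X + _ + _](Ex_cst P 1) -(ExZ x z1) -(ExZ K z2).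
  rewrite -(ExD (itg_cst P 1) (itgZ x z1)) -(ExD i1 (itgZ K z2)).
  apply: Ex_le.
  - apply: (@itg_bounded _ _ _ P (expR (`|x| * b))).
      exact: measurableT_comp (derive_measurable (is_derive_expRZ x)) mz.
    move=> w; rewrite ger0_norm ?expR_ge0// ler_expR (le_trans (ler_norm _))// normrM.
    by rewrite ler_wpM2l.
  - by apply: itgD; [apply: itgD; [exact: itg_cst|exact: itgZ]|exact: itgZ].
  - by move=> w; exact: step.
apply: (le_trans muP); apply: (le_trans _ (expR_ge1Dx _)).
have hn : n%:R * h = 1 by rewrite mulfV// gt_eqF// ltr0n.
have key : expR 1 * (1 + `|x|) ^+ 3 * lerr n <= h.
  rewrite -[leRHS]mul1r -ler_pdivrMr//; apply: le_trans H.
  by rewrite invrK; lra.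
apply: (@le_trans _ _ (1 + (x ^+ 2 * h / 2 + expR 1 * (1 + `|x|) ^+ 3 * lerr n))); last by lra.
have e1 : 1 <= expR 1 :> R by rewrite -expR0 ler_expR.
set e := expR 1 in e1 *; set L := 1 + `|x|.
have x0 := normr_ge0 x.
have L1 : 1 <= L by rewrite lerDl.
have L3 : 1 <= L ^+ 3 by rewrite exprn_ege1.
have xL : `|x| <= L ^+ 3 by apply: (@le_trans _ _ L); [rewrite lerDr|rewrite -[leLHS]expr1 ler_weXn2l].
have x2L : x ^+ 2 <= L ^+ 3.
  apply: (@le_trans _ _ (L ^+ 2)); last by rewrite ler_weXn2l.
  by rewrite -real_normK ?num_real// lerXn2r ?nnegrE ?addr_ge0// lerDr.
have x3L : `|x| ^+ 3 <= L ^+ 3 by rewrite lerXn2r ?nnegrE ?addr_ge0// lerDr.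
have L30 : 0 <= L ^+ 3 by exact: le_trans L3.
have eL z : z <= L ^+ 3 -> z <= e * L ^+ 3.
  by move=> zL; apply: (le_trans zL); rewrite ler_peMl.
have a1 : x * m <= e * L ^+ 3 * `|m|.
  by rewrite (le_trans (ler_norm _))// normrM ler_wpM2r// eL.
have a2 : x ^+ 2 * (v - h) / 2 <= e * L ^+ 3 * `|v - h|.
  have : x ^+ 2 * (v - h) <= x ^+ 2 * `|v - h| by rewrite ler_wpM2l ?sqr_ge0// ler_norm.
  have : x ^+ 2 * `|v - h| <= e * L ^+ 3 * `|v - h| by rewrite ler_wpM2r// eL.
  have : 0 <= x ^+ 2 * `|v - h| by rewrite mulr_ge0// sqr_ge0.
  lra.
have a3 : e * `|x| ^+ 3 * b * v <= e * L ^+ 3 * (b * v).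
  rewrite -mulrA; apply: ler_wpM2r; first by rewrite mulr_ge0.
  by apply: ler_wpM2l => //; apply: le_trans e1.
have a4 : 0 <= e * L ^+ 3 * n%:R ^- 2.
  by rewrite mulr_ge0// ?invr_ge0 ?exprn_ge0// (le_trans L30)// ler_peMl.
by rewrite /lerr -/h; lra.
Qed.

(** Telescoping from n variables with variance U^-2 to none with variance 1 + U^-2. The weight at
    step k has mean exp(- x^2 + x^2 t / 2) mu^k: time left and time spent add up to about 1, so the
    exponent stays below 2 - x^2 / 2 at every step. *)
Lemma smooth_tsum (n : nat) (U : R) : (0 < n)%N -> 1 <= U -> x ^+ 2 <= 2 * U ^+ 2 ->
  `|x| * b <= 1 -> expR 1 * (1 + `|x|) ^+ 3 * (n%:R * lerr n) <= 1 ->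
  `|Ex P (fun w => W0 x (U ^- 2) (S n w)) - gtail (x / Num.sqrt (1 + U ^- 2))| <=
  expR 3 * dconst x U * expR (- x ^+ 2 / 2) * (n%:R * lerr n).
Proof.
move=> n0 U1 xU xb H; pose h : R := n%:R^-1.
have U0 : 0 < U by exact: lt_le_trans U1.
have h0 : 0 < h by rewrite invr_gt0 ltr0n.
have nh : n%:R * h = 1 by rewrite mulfV// gt_eqF// ltr0n.
have Ui0 : 0 < U ^- 2 by rewrite invr_gt0 exprn_gt0.
have Ui1 : U ^- 2 <= 1 by rewrite invf_le1 ?exprn_gt0// exprn_ege1.
have xU' : x ^+ 2 * U ^- 2 <= 2 by rewrite ler_pdivrMr ?exprn_gt0.
have D0 := dconst_ge0 x (ltW U0).
have xh : x ^+ 2 * h <= 2.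
  have e1 : 1 <= expR 1 :> R by rewrite -expR0 ler_expR.
  have L1 : 1 <= 1 + `|x| by rewrite lerDl.
  (* [lerr n] contains n^-2, so the hypothesis [H] also controls x^2 / n. *)
  have hl : h <= n%:R * lerr n.
    apply: (@le_trans _ _ (n%:R * n%:R ^- 2)).
      by rewrite expr2 invfM mulrA nh mul1r.
    by rewrite ler_wpM2l// lerDr !addr_ge0// mulr_ge0.
  have x2L : x ^+ 2 <= (1 + `|x|) ^+ 3.
    apply: (@le_trans _ _ ((1 + `|x|) ^+ 2)); last by rewrite ler_weXn2l.
    by rewrite -real_normK ?num_real// lerXn2r ?nnegrE ?addr_ge0// lerDr.
  apply: (@le_trans _ _ 1); last by rewrite ler1n.
  apply: le_trans H; rewrite ler_pM ?sqr_ge0 ?(ltW h0)//.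
  by apply: (le_trans x2L); rewrite ler_peMl// exprn_ge0// addr_ge0.
have muP := mgf_le n0 xb H; rewrite -/h in muP.
(* The variance at step k: the smoothing plus 1/n for each of the n - k variables not yet added. *)
pose t k := U ^- 2 + (n - k)%:R * h.
pose a k := Ex P (fun w => W0 x (t k) (S k w)).
have an : a n = Ex P (fun w => W0 x (U ^- 2) (S n w)) by rewrite /a /t subnn mul0r addr0.
have a0 : a 0 = gtail (x / Num.sqrt (1 + U ^- 2)).
  rewrite /a /t subn0 nh addrC -[RHS](Ex_cst P); congr Ex; apply/funext => w.
  by rewrite /S /tsum big_ord0 /W0 subr0.
rewrite -an -a0 -(telescope_sumr _ (leq0n n)) big_mkord.
apply: (le_trans (ler_norm_sum _ _ _)).
have -> : expR 3 * dconst x U * expR (- x ^+ 2 / 2) * (n%:R * lerr n) =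
   \sum_(k < n) (expR 3 * dconst x U * expR (- x ^+ 2 / 2) * lerr n).
  by rewrite sumr_const card_ord -mulr_natl; ring.
apply: ler_sum => k _.
have nk : (n - k)%:R * h = (n - k.+1)%:R * h + h.
  by rewrite -[X in _ + X]mul1r -mulrDl natr1 subnSK.
have k0 : 0 <= (n - k.+1)%:R * h by exact: mulr_ge0 (ler0n _ _) (ltW h0).
have kn : k%:R * h + (n - k.+1)%:R * h + h = 1.
  by rewrite -addrA -nk -mulrDl -natrD subnKC; [exact: nh|exact: (ltnW (ltn_ord k))].
have kh0 : 0 <= k%:R * h by exact: mulr_ge0 (ler0n _ _) (ltW h0).
have tk : t k = t k.+1 + h by rewrite /t nk addrA.
have Ut : U ^- 2 <= t k.+1 by rewrite lerDl.
have th2 : t k.+1 + h <= 2.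
  exact: time_split_le kn Ui1 kh0.
rewrite /a tk.
apply: (le_trans (tsum_step Xst Xassoc Xsq Xuncor c_incr c_le k U1 Ut (ltW h0) th2 xb xh)).
rewrite -/m -/v -/mu exprVn -/(lerr n).
apply: ler_wpM2r; first exact: lerr_ge0.
have -> : expR 3 = expR 1 * expR 2 :> R by rewrite -expRD; congr expR; ring.
have -> : expR 1 * expR 2 * dconst x U * expR (- x ^+ 2 / 2) =
  expR 1 * dconst x U * (expR 2 * expR (- x ^+ 2 / 2)) by ring.
apply: ler_wpM2l; first by rewrite mulr_ge0// expR_ge0.
have muk : mu ^+ k <= expR (k%:R * (x ^+ 2 * h / 2 + h)).
  rewrite expRM_natl; apply: lerXn2r muP; rewrite nnegrE; last exact: expR_ge0.
  by apply: Ex_ge0 => w; exact: expR_ge0.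
apply: (le_trans (ler_wpM2l (expR_ge0 _) muk)).
rewrite -!expRD ler_expR /t.
have -> : k%:R * (x ^+ 2 * h / 2 + h) = (x ^+ 2 / 2 + 1) * (k%:R * h).
  exact: exponent_split.
exact: exponent_split_le kn (mulr_ge0 (sqr_ge0 x) (ltW h0)) k0 (ltW h0) xU'.
Qed.

End smooth.

(** * Relative cost of the shift and of the smoothing *)

Section smooth_close.
Context {R : realType}.
Implicit Types (V x y g : R).

Lemma sqrt1D_bounds (a : R) : 0 <= a -> 1 <= Num.sqrt (1 + a) <= 1 + a.
Proof.
move=> a0; have h : 1 <= 1 + a by rewrite lerDl.
have s1 : 1 <= Num.sqrt (1 + a) by rewrite -[leLHS]sqrtr1 ler_wsqrtr.
rewrite s1/= -[leRHS]sqr_sqrtr ?(le_trans _ h)// expr2 ler_peMr// (le_trans _ s1)//.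
Qed.

(** The shift moves x by V^-3 and the normalization by at most V V^-8, so the total is at most 2
    V^-3; the Mills ratio then costs one factor 1 + |x| <= V. *)
Lemma gtail_close V x y : 2 <= V -> 1 + `|x| <= V -> `|y - x| <= V ^- 3 ->
  `|gtail (y / Num.sqrt (1 + (V ^+ 4) ^- 2)) - gtail x| <= 2 * expR 2 * V^-1 * gtail x.
Proof.
move=> V2 xV yx; have V0 : 0 < V by lra.
have V1 : 1 <= V by lra.
set a := (V ^+ 4) ^- 2.
have a0 : 0 <= a by rewrite invr_ge0 exprn_ge0// exprn_ge0// ltW.
have aE : a = V ^- 8 by rewrite /a -exprM.
have /andP[s1 s2] := sqrt1D_bounds a0; set s := Num.sqrt (1 + a) in s1 s2 *.
have s0 : 0 < s by lra.
have si1 : s^-1 <= 1 by rewrite invf_le1.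
have si2 : 1 - s^-1 <= a.
  have -> : 1 - s^-1 = (s - 1) / s by field; rewrite gt_eqF.
  rewrite ler_pdivrMr//; nra.
have x0 := normr_ge0 x.
have dist : `|x - y / s| <= 2 * V ^- 3.
  have -> : x - y / s = (x - y) * s^-1 + x * (1 - s^-1) by ring.
  rewrite (le_trans (ler_normD _ _))// mulr_natl mulr2n lerD// normrM.
    rewrite distrC gtr0_norm ?invr_gt0// -[leRHS]mulr1 ler_pM// invr_ge0 ltW//.
  rewrite (@ger0_norm _ (1 - s^-1)) ?subr_ge0//.
  apply: (@le_trans _ _ (V * V ^- 8)).
    by rewrite -aE ler_pM ?subr_ge0//; lra.
  have -> : V * V ^- 8 = V ^- 7 by field; rewrite gt_eqF.
  by rewrite lef_pV2 ?posrE ?exprn_gt0// ler_weXn2l.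
have VV : V ^- 3 * V = V ^- 2 by field; rewrite gt_eqF.
have V21 : V ^- 2 <= V^-1.
  by rewrite lef_pV2 ?posrE ?exprn_gt0// -[leLHS]expr1 ler_weXn2l.
have Vi0 : 0 <= V ^- 3 by rewrite invr_ge0 exprn_ge0// ltW.
have Vi1 : V ^- 2 <= 1 by rewrite invf_le1 ?exprn_gt0// exprn_ege1.
have ex : `|x| * `|x - y / s| <= 2.
  apply: (@le_trans _ _ (V * (2 * V ^- 3))); first by rewrite ler_pM//; lra.
  by rewrite mulrCA (mulrC V) VV; lra.
apply: (le_trans (gtail_lipschitz x (y / s))); rewrite mulrA ler_wpM2r ?gtail_ge0//.
apply: (@le_trans _ _ (2 * V ^- 3 * expR 2 * V)).
  rewrite ler_pM// ?mulr_ge0 ?expR_ge0//.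
  by rewrite ler_pM ?expR_ge0// ler_expR.
have -> : 2 * V ^- 3 * expR 2 * V = 2 * expR 2 * (V ^- 3 * V) by ring.
by rewrite VV ler_wpM2l// mulr_ge0// expR_ge0.
Qed.

(** Returning from y to x costs at most e, since |x| V^-3 <= 1, and the Mills ratio costs V. *)
Lemma gauss_shift_le V x y : 2 <= V -> 1 + `|x| <= V -> `|y - x| <= V ^- 3 ->
  expR (- y ^+ 2 / 2) <= (normal_peak 1)^-1 * expR 1 * V * gtail x.
Proof.
move=> V2 xV yx; have V0 : 0 < V by lra.
have p0 := @normal_peak1_gt0 R.
have x0 := normr_ge0 x.
have h1 := gpdf_shift x y; have h2 := gpdf_le_gtail x.
have ex : expR (`|x| * `|x - y|) <= expR 1.
  rewrite ler_expR distrC; apply: (@le_trans _ _ (V * V ^- 3)).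
    by rewrite ler_pM//; lra.
  have -> : V * V ^- 3 = V ^- 2 by field; rewrite gt_eqF.
  by rewrite invf_le1 ?exprn_gt0// exprn_ege1//; lra.
rewrite gpdfE in h1; rewrite mulNr.
have -> : (normal_peak 1)^-1 * expR 1 * V * gtail x =
  (normal_peak 1)^-1 * (expR 1 * (V * gtail x)) by ring.
rewrite ler_pdivlMl//.
apply: (le_trans h1); rewrite mulrC; apply: ler_pM; rewrite ?expR_ge0//.
  exact/ltW/gpdf_gt0.
by apply: (le_trans h2); rewrite ler_wpM2r// gtail_ge0.
Qed.

(* The constant of [smooth_close]; [1 / normal_peak 1] converts the Gaussian
   weight of the Lindeberg bound into a tail probability. *)
Definition close_const : R :=
  2 * expR 2 + expR 3 * (512 * 8) * ((normal_peak 1)^-1 * expR 1).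

Lemma close_const_ge0 : 0 <= close_const.
Proof.
apply: addr_ge0; first by apply: mulr_ge0 (expR_ge0 _); exact: ler0n.
apply: mulr_ge0; last by apply: mulr_ge0 (expR_ge0 _); rewrite invr_ge0 normal_peak_ge0.
by apply: mulr_ge0 (expR_ge0 _) _; apply: mulr_ge0; exact: ler0n.
Qed.

Lemma dconst_le V y : 1 <= V -> 1 + `|y| <= 2 * V -> dconst y (V ^+ 4) <= 512 * 8 * V ^+ 31.
Proof.
move=> V1 yV; have V0 : 0 <= V by lra.
have -> : 512 * 8 * V ^+ 31 = 512 * (2 * V) ^+ 3 * (V ^+ 4) ^+ 7 by ring.
rewrite /dconst; apply: ler_wpM2r; first by rewrite exprn_ge0// exprn_ge0.
apply: ler_wpM2l; first exact: ler0n.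
apply: lerXn2r yV; rewrite nnegrE; first exact: addr_ge0.
by apply: mulr_ge0 V0; exact: ler0n.
Qed.

End smooth_close.

(** * The smoothed truncated sum relative to the Gaussian tail *)

Section tsum_close.
Context {d : measure_display} {T : measurableType d} {R : realType}.
Variables (P : probability T R) (X : nat -> {RV P >-> R}).
Hypothesis Xst : strictly_stationary P (fun n => X n).
Hypothesis Xassoc : associated P (fun n => X n).
Hypothesis Xsq : forall n, sqi P (X n).
Hypothesis Xuncor : forall i j, (i < j)%N -> cv P (X i) (X j) = 0.
Variables (c : R -> R) (b l : R).
Hypothesis c_incr : forall u v, u <= v -> 0 <= c v - c u <= l * (v - u).
Hypothesis c_le : forall u, `|c u| <= b.

(** The exponent 33 is fixed by the balance: [dconst] at U = V^4 contributes V^(3 + 28), the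
    conversion into a tail one more V, and one V^-1 must be left over. *)
Lemma smooth_close (n : nat) (V x y : R) : (0 < n)%N ->
  8 <= V -> expR 1 <= V -> 1 + `|x| <= V -> `|y - x| <= V ^- 3 ->
  2 * V * b <= 1 -> n%:R * lerr X c b n <= V ^- 33 ->
  `|Ex P (fun w => W0 y ((V ^+ 4) ^- 2) (tsum X c n w)) - gtail x| <=
  close_const * V^-1 * gtail x.
Proof.
move=> n0 V8 Ve xV yx Vb EV.
have V0 : 0 < V by lra.
have V1 : 1 <= V by lra.
have V2 : 2 <= V by lra.
have Vne : V != 0 by rewrite gt_eqF.
have Vi1 : V ^- 3 <= 1 by rewrite invf_le1 ?exprn_gt0// exprn_ege1.
have yV : 1 + `|y| <= 2 * V.
  have -> : y = (y - x) + x by ring.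
  by have := ler_normD (y - x) x; lra.
have E0 : 0 <= n%:R * lerr X c b n by rewrite mulr_ge0// lerr_ge0.
have U1 : 1 <= V ^+ 4 by rewrite exprn_ege1.
have y0 := normr_ge0 y.
have b0 : 0 <= b by exact: b_ge0 c_le.
have yU : y ^+ 2 <= 2 * (V ^+ 4) ^+ 2.
  apply: (@le_trans _ _ ((2 * V) ^+ 2)).
    by rewrite -real_normK ?num_real// lerXn2r ?nnegrE//; lra.
  apply: (@le_trans _ _ ((V ^+ 4) ^+ 2)); last by have := sqr_ge0 (V ^+ 4); lra.
  rewrite lerXn2r ?nnegrE ?exprn_ge0//; do ?lra.
  rewrite (exprS V 3) mulrC ler_wpM2l//; first exact: ltW.
  by apply: (le_trans V2); rewrite -[leLHS]expr1 ler_weXn2l.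
have yb : `|y| * b <= 1.
  by apply: le_trans Vb; rewrite ler_wpM2r//; lra.
have H : expR 1 * (1 + `|y|) ^+ 3 * (n%:R * lerr X c b n) <= 1.
  apply: (@le_trans _ _ (V * (V ^+ 6) * V ^- 33)).
    have L30 : 0 <= (1 + `|y|) ^+ 3 by rewrite exprn_ge0// addr_ge0.
    have L3V : (1 + `|y|) ^+ 3 <= V ^+ 6.
      have -> : V ^+ 6 = (V ^+ 2) ^+ 3 by ring.
      apply: lerXn2r; rewrite ?nnegrE; [exact: addr_ge0|exact/exprn_ge0/ltW|].
      by apply: (le_trans yV); rewrite expr2 ler_wpM2r// ltW.
    exact: ler_pM (mulr_ge0 (expR_ge0 1) L30) E0 (ler_pM (expR_ge0 1) L30 Ve L3V) EV.
  have -> : V * V ^+ 6 * V ^- 33 = V ^- 26 by field.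
  by rewrite invf_le1 ?exprn_gt0// exprn_ege1.
have hs := smooth_tsum Xst Xassoc Xsq Xuncor c_incr c_le n0 U1 yU yb H.
have hc := gtail_close V2 xV yx.
set A := Ex P _ in hs *; set B := gtail (y / _) in hs hc.
have -> : A - gtail x = (A - B) + (B - gtail x) by ring.
set k := expR 3 * (512 * 8) * ((normal_peak 1)^-1 * expR 1) : R.
have kE : close_const * V^-1 * gtail x =
    k * V^-1 * gtail x + 2 * expR 2 * V^-1 * gtail x.
  by rewrite /close_const -/k; ring.
rewrite kE; apply: (le_trans (ler_normD _ _)); apply: lerD hc.
apply: (le_trans hs); rewrite /k.
have g0 := gtail_ge0 x.
have hd := dconst_le V1 yV.
have hg := gauss_shift_le V2 xV yx.
have D0 := dconst_ge0 y (le_trans ler01 U1).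
set pe := (normal_peak 1)^-1 * expR 1 in hg *.
have -> : expR 3 * (512 * 8) * pe / V * gtail x =
   expR 3 * (512 * 8 * V ^+ 31) * (pe * V * gtail x) * V ^- 33.
  by field.
have eg := expR_ge0 (- y ^+ 2 / 2).
have q := ler_pM (mulr_ge0 (expR_ge0 3) D0) eg (ler_wpM2l (expR_ge0 3) hd) hg.
exact: ler_pM (mulr_ge0 (mulr_ge0 (expR_ge0 3) D0) eg) E0 q EV.
Qed.

End tsum_close.

(** * Truncation and its moments *)

Section truncation.
Context {R : realType}.
Implicit Types (tau s u q r : R).

(** Clamping rather than cutting off to 0: the map stays nondecreasing and 1-Lipschitz, as
    association and Newman's argument demand. *)
Definition clamp tau u : R := Num.max (- tau) (Num.min tau u).

Lemma clamp_abs tau u : 0 <= tau -> `|clamp tau u| <= tau.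
Proof.
move=> t0; rewrite /clamp ler_norml le_max ge_max ge_min lexx/= andbT.
by rewrite lexx; lra.
Qed.

Lemma clamp_incr tau u v : 0 <= tau -> u <= v ->
  0 <= clamp tau v - clamp tau u <= v - u.
Proof.
move=> t0 uv; rewrite /clamp /Num.max /Num.min.
by do ![case: ifPn]; rewrite -?leNgt; lra.
Qed.

Lemma clamp_id tau u : `|u| <= tau -> clamp tau u = u.
Proof.
rewrite ler_norml /clamp => /andP[h1 h2].
by rewrite (min_idPr h2) (max_idPr h1).
Qed.

Lemma clamp_norm_le tau u : 0 <= tau -> `|clamp tau u| <= `|u| /\ `|clamp tau u - u| <= `|u|.
Proof.
move=> t0; have := @clamp_incr tau 0 u t0; have := @clamp_incr tau u 0 t0.
rewrite (@clamp_id tau 0) ?normr0// subr0 !sub0r.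
have [u0|/ltW u0] := leP 0 u.
  by move=> _ /(_ isT) h; split; rewrite ler_norml (ger0_norm u0); lra.
by move=> /(_ u0) h _; split; rewrite ler_norml (ler0_norm u0); lra.
Qed.

(** Above tau, the missing factor a^(q - r) is at least tau^(q - r). The values r = 0, 1, 2 bound
    the probability, the mean and the variance lost. *)
Lemma powR_trunc tau q r (a : R) : 0 < tau -> tau < a -> r <= q ->
  a `^ r <= a `^ q * tau `^ (r - q).
Proof.
move=> t0 ta rq; have a0 : 0 < a by exact: lt_trans ta.
have -> : a `^ r = a `^ q * a `^ (r - q).
  by rewrite -powRD; [rewrite addrC subrK|rewrite (gt_eqF a0) implybT].
rewrite ler_wpM2l ?powR_ge0// -opprB !powRN lef_pV2 ?posrE ?powR_gt0//.
by apply: ge0_ler_powR; rewrite ?nnegrE ?subr_ge0// ltW.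
Qed.

Lemma trunc0 tau q u : 0 < tau -> tau < `|u| -> 0 <= q ->
  1 <= `|u| `^ q * tau `^ (- q).
Proof.
by move=> t0 tu q0; have := powR_trunc t0 tu q0; rewrite powRr0 sub0r.
Qed.

Lemma trunc1 tau q u : 0 < tau -> 1 <= q ->
  `|clamp tau u - u| <= `|u| `^ q * tau `^ (1 - q).
Proof.
move=> t0 q1; have [ut|ut] := leP `|u| tau.
  by rewrite clamp_id// subrr normr0 mulr_ge0// powR_ge0.
have := powR_trunc t0 ut q1; rewrite powRr1//; apply: le_trans.
by have [] := clamp_norm_le u (ltW t0).
Qed.

Lemma trunc2 tau q u : 0 < tau -> 2 <= q ->
  0 <= u ^+ 2 - clamp tau u ^+ 2 <= `|u| `^ q * tau `^ (2 - q).
Proof.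
move=> t0 q2; have [h _] := clamp_norm_le u (ltW t0).
have h2 : clamp tau u ^+ 2 <= u ^+ 2.
  by rewrite -(real_normK (num_real u)) -(real_normK (num_real (clamp _ _))) lerXn2r// nnegrE.
rewrite subr_ge0 h2/=; have [ut|ut] := leP `|u| tau.
  by rewrite clamp_id// subrr mulr_ge0// powR_ge0.
have := powR_trunc t0 ut q2; rewrite powR_mulrn// real_normK ?num_real//.
by apply: le_trans; rewrite gerBl sqr_ge0.
Qed.

End truncation.

(** * From the event to the smoothed truncated sum *)

Section sandwich.
Context {d : measure_display} {T : measurableType d} {R : realType}.
Variables (P : probability T R) (X : nat -> {RV P >-> R}).
Hypothesis Xst : strictly_stationary P (fun n => X n).
Hypothesis Xsq : forall n, sqi P (X n).
Hypothesis X0 : Ex P (X 0) = 0.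
Variables (q : R).
Hypothesis q2 : 2 < q.
Hypothesis Xq : itg P (fun w => `|X 0 w| `^ q).
Let K := Ex P (fun w => `|X 0 w| `^ q).
Variables (n : nat) (s tau : R).
Hypotheses (n0 : (0 < n)%N) (s0 : 0 < s) (t0 : 0 < tau).
Hypothesis s2 : s ^+ 2 = n%:R * Ex P (fun w => X 0 w ^+ 2).

Definition trunc (s tau u : R) := clamp tau u / s.

Lemma trunc_incr u v : u <= v -> 0 <= trunc s tau v - trunc s tau u <= s^-1 * (v - u).
Proof.
move=> uv; have /andP[h1 h2] := clamp_incr (ltW t0) uv.
rewrite /trunc -mulrBl mulr_ge0// ?invr_ge0 ?(ltW s0)//= mulrC ler_wpM2l//.
by rewrite invr_ge0 ltW.
Qed.

Lemma trunc_le u : `|trunc s tau u| <= tau / s.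
Proof.
rewrite normrM (gtr0_norm (_ : 0 < s^-1)) ?invr_gt0//.
by rewrite ler_wpM2r ?invr_ge0 ?(ltW s0)// clamp_abs// ltW.
Qed.

Let mclamp : measurable_fun [set: R] (clamp tau).
Proof.
apply: nondecreasing_measurable => // u v uv.
by have /andP[] := clamp_incr (ltW t0) uv; rewrite subr_ge0.
Qed.

Let clS : sqi P (fun w => clamp tau (X 0 w)).
Proof.
apply: (@sqi_bounded _ _ _ P tau); first exact: measurableT_comp mclamp _.
by move=> w; rewrite clamp_abs// ltW.
Qed.

(** As X_0 is centered, the mean of its clamped version is that of the difference, which lives on
    |X_0| > tau. *)
Lemma trunc_mean_le : `|Ex P (fun w => trunc s tau (X 0 w))| <= K * tau `^ (1 - q) / s.
Proof.
have xi := sqi_itg (Xsq 0); have ci := sqi_itg clS.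
have -> : Ex P (fun w => trunc s tau (X 0 w)) =
    s^-1 * Ex P (fun w => clamp tau (X 0 w) - X 0 w).
  rewrite (ExB ci xi) X0 subr0 -(ExZ _ ci).
  by congr Ex; apply/funext => w; rewrite mulrC.
rewrite normrM (gtr0_norm (_ : 0 < s^-1)) ?invr_gt0// mulrC.
rewrite ler_wpM2r ?invr_ge0 ?(ltW s0)// mulrC -(ExZ _ Xq).
apply: Ex_abs_le; [exact: itgB|exact: itgZ|move=> w].
have q1 : 1 <= q by have := q2; lra.
by rewrite [leRHS]mulrC; exact: trunc1.
Qed.

(** The normalization s^2 = n E X_0^2 makes 1/n the exact second moment of X_0 / s, so only the part
    removed by clamping counts, and it has a sign. *)
Lemma trunc_var_le :
  `|Ex P (fun w => trunc s tau (X 0 w) ^+ 2) - n%:R^-1| <= K * tau `^ (2 - q) / s ^+ 2 /\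
  Ex P (fun w => trunc s tau (X 0 w) ^+ 2) <= n%:R^-1.
Proof.
have [[_ xi] [_ ci]] := (Xsq 0, clS).
have nE : n%:R^-1 = s ^- 2 * Ex P (fun w => X 0 w ^+ 2).
  have s2n : s ^+ 2 != 0 by rewrite gt_eqF// exprn_gt0.
  have nn : n%:R != 0 :> R by rewrite pnatr_eq0 -lt0n.
  apply: (mulfI s2n); rewrite mulrA mulfV// mul1r s2 mulrAC mulfV// mul1r//.
have -> : Ex P (fun w => trunc s tau (X 0 w) ^+ 2) =
    s ^- 2 * Ex P (fun w => clamp tau (X 0 w) ^+ 2).
  rewrite -(ExZ _ ci); congr Ex; apply/funext => w.
  by rewrite /trunc exprMn exprVn mulrC.
have si0 : 0 <= s ^- 2 by rewrite invr_ge0 exprn_ge0// ltW.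
have tr w := trunc2 (X 0 w) t0 (ltW q2).
split; last first.
  rewrite nE ler_wpM2l//; apply: Ex_le => // w.
  by have /andP[] := tr w; rewrite subr_ge0.
rewrite nE -mulrBr normrM (ger0_norm si0) mulrC ler_wpM2r// -(ExB ci xi) mulrC -(ExZ _ Xq).
apply: Ex_abs_le; [exact: itgB|exact: itgZ|move=> w].
by have /andP[h1 h2] := tr w; rewrite distrC ger0_norm// mulrC.
Qed.

Lemma lerr_trunc_le : n%:R * lerr X (trunc s tau) (tau / s) n <=
  n%:R * (K * tau `^ (1 - q) / s) + n%:R * (K * tau `^ (2 - q) / s ^+ 2) + tau / s + n%:R^-1.
Proof.
have [v1 v2] := trunc_var_le; have m1 := trunc_mean_le.
have nn : 0 < n%:R :> R by rewrite ltr0n.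
have ts : 0 <= tau / s by rewrite divr_ge0// ltW.
rewrite /lerr !mulrDr.
apply: lerD; last by rewrite expr2 invfM mulrA mulfV ?mul1r// gt_eqF.
apply: lerD; last first.
  rewrite mulrCA ger_pMr ?divr_gt0//.
  by rewrite mulrC -ler_pdivlMr// mul1r.
by apply: lerD; rewrite ler_wpM2l// ltW.
Qed.

Let mpow : measurable_fun [set: R] (fun u : R => `|u| `^ q).
Proof.
apply: (measurableT_comp (measurable_powR q)); exact: measurable_realfun.normr_measurable.
Qed.

(** A pathwise Markov bound: a single |X_k| > tau already makes [D] at least 1, and its mean is the
    union bound. *)
Let D w := \sum_(k < n) (tau `^ (- q) * `|X k w| `^ q).

Let Di : itg P D.
Proof.
apply: (itg_sum n (F := fun k w => tau `^ (- q) * `|X k w| `^ q)) => k.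
by apply: itgZ; have [] := stationary_Ex Xst k mpow Xq.
Qed.

Let ED : Ex P D = n%:R * (K * tau `^ (- q)).
Proof.
rewrite (@Ex_sum _ _ _ P n (fun k w => tau `^ (- q) * `|X k w| `^ q)) => [|k]; last first.
  by apply: itgZ; have [] := stationary_Ex Xst k mpow Xq.
under eq_bigr => k _.
  have [ik ek] := stationary_Ex Xst k mpow Xq.
  rewrite (ExZ _ ik) ek mulrC; over.
by rewrite sumr_const card_ord mulr_natl.
Qed.

Let D_ge0 w : 0 <= D w.
Proof. by apply: sumr_ge0 => k _; rewrite mulr_ge0// powR_ge0. Qed.

Lemma tsum_untruncated w : D w < 1 -> tsum X (trunc s tau) n w = (\sum_(k < n) X k w) / s.
Proof.
move=> D1; rewrite /tsum mulr_suml; apply: eq_bigr => k _.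
rewrite /trunc clamp_id// leNgt; apply/negP => kt.
have q0 : 0 <= q by have := q2; lra.
have := trunc0 t0 kt q0; rewrite mulrC leNgt => /negP; apply.
apply: le_lt_trans D1; rewrite /D (bigD1 k)//= lerDl.
by apply: sumr_ge0 => j _; rewrite mulr_ge0// powR_ge0.
Qed.

Variables (V x : R).
Hypothesis V1 : 1 <= V.
Let p := fine (P [set w | x * s < \sum_(k < n) X k w]).
Let kap := expR (- (V ^+ 2 / 2)).
Let A := [set w | x * s < \sum_(k < n) X k w].

Let mA : measurable A.
Proof.
have mS : measurable_fun [set: T] (fun w => \sum_(k < n) X k w).
  by apply: measurable_sum => k.
rewrite -[A]setTI; have := mS measurableT `]x * s, +oo[%classic (measurable_itv _).
congr (measurable (_ `&` _)); apply/seteqP; split => w/=; rewrite in_itv/= andbT//.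
Qed.

Let sqV : Num.sqrt ((V ^+ 4) ^- 2) = (V ^+ 4)^-1.
Proof. by rewrite -exprVn sqrtr_sqr ger0_norm// invr_ge0 exprn_ge0// (le_trans ler01). Qed.

Let W0i y : itg P (fun w => W0 y ((V ^+ 4) ^- 2) (tsum X (trunc s tau) n w)).
Proof.
apply: (@itg_bounded _ _ _ P 1).
  apply: measurableT_comp; last exact: (tsum_measurable X trunc_incr n).
  apply: derive_measurable (is_derive_W0 y _).
  by rewrite invr_gt0 !exprn_gt0// (lt_le_trans ltr01).
by move=> w; rewrite ger0_norm ?gtail_ge0// gtail_le1.
Qed.

Let V4 : V ^- 3 * V ^+ 4 = V.
Proof. by field; rewrite gt_eqF// (lt_le_trans ltr01). Qed.

Let V40 : 0 < V ^+ 4. Proof. by rewrite exprn_gt0// (lt_le_trans ltr01). Qed.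

(** The inequality holds pointwise. Where [D] >= 1, [D] alone suffices. Elsewhere the sum is
    untruncated, and on the event the argument of [gtail] is at most - V^-3 V^4 = - V, so that [W0]
    is at least 1 - [kap]. *)
Lemma prob_upper : p <= Ex P (fun w => W0 (x - V ^- 3) ((V ^+ 4) ^- 2)
  (tsum X (trunc s tau) n w)) + kap + n%:R * (K * tau `^ (- q)).
Proof.
rewrite /p -(Ex_indic P mA) -ED -[kap](Ex_cst P).
rewrite -(ExD (W0i _) (itg_cst P _)) -(ExD (itgD (W0i _) (itg_cst P _)) Di).
apply: Ex_le; [exact: itg_indic|by apply: itgD => //; apply: itgD; [exact: W0i|exact: itg_cst]|].
move=> w; have W := gtail_ge0 ((x - V ^- 3 - tsum X (trunc s tau) n w) / Num.sqrt ((V ^+ 4) ^- 2)).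
have k0 : 0 <= kap by exact: expR_ge0.
have Dw := D_ge0 w.
rewrite indicE; have [|_] := boolP (w \in A); last by move: W; rewrite /W0 /=; lra.
rewrite inE /A/= => Aw; have [D1|D1] := leP 1 (D w); first by rewrite /W0; lra.
rewrite /W0 (tsum_untruncated D1) sqV invrK in W *.
have h : x <= (\sum_(k < n) X k w) / s by rewrite ler_pdivlMr// ltW.
have : gtail (- V) <= gtail ((x - V ^- 3 - (\sum_(k < n) X k w) / s) * V ^+ 4).
  have VN : - V = - V ^- 3 * V ^+ 4 by rewrite mulNr V4.
  by apply: gtail_nincr; rewrite [leRHS]VN ler_wpM2r ?(ltW V40)//; lra.
have := gtailN_ge V1; rewrite -/kap; lra.
Qed.

Lemma prob_lower : Ex P (fun w => W0 (x + V ^- 3) ((V ^+ 4) ^- 2)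
  (tsum X (trunc s tau) n w)) <= p + kap + n%:R * (K * tau `^ (- q)).
Proof.
rewrite /p -(Ex_indic P mA) -ED -[kap](Ex_cst P).
rewrite -(ExD (itg_indic P mA) (itg_cst P _)) -(ExD (itgD (itg_indic P mA) (itg_cst P _)) Di).
apply: Ex_le; [exact: W0i|by apply: itgD => //; apply: itgD; [exact: itg_indic|exact: itg_cst]|].
move=> w; have W := gtail_le1 ((x + V ^- 3 - tsum X (trunc s tau) n w) / Num.sqrt ((V ^+ 4) ^- 2)).
have k0 : 0 <= kap by exact: expR_ge0.
have Dw := D_ge0 w.
rewrite indicE; have [_|] := boolP (w \in A); first by move: W; rewrite /W0 /=; lra.
rewrite notin_setE /A/= => /negP; rewrite -leNgt => Aw.
have [D1|D1] := leP 1 (D w); first by rewrite /W0; lra.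
rewrite /W0 (tsum_untruncated D1) sqV invrK in W *.
have h : (\sum_(k < n) X k w) / s <= x by rewrite ler_pdivrMr.
have : gtail ((x + V ^- 3 - (\sum_(k < n) X k w) / s) * V ^+ 4) <= gtail V.
  by apply: gtail_nincr; rewrite -[leLHS]V4 ler_wpM2r ?(ltW V40)//; lra.
have := gtail_le V1; rewrite -/kap; lra.
Qed.

End sandwich.

(** * Bounds drawn from an upper limit *)

Section limsup.
Context {R : realType}.
Implicit Types u : nat -> R.

Lemma limn_esup_near_le u (l l' : R) : limn_esup (fun n => (u n)%:E) = l%:E -> l < l' ->
  \forall n \near \oo, u n <= l'.
Proof.
move=> ul ll'; have : (limn_esup (fun n => (u n)%:E) < l'%:E)%E by rewrite ul lte_fin.
move=> /ereal_inf_ltP[_ [V Voo <-] Vl'].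
apply: filterS Voo => n Vn; rewrite -lee_fin; apply: le_trans (ltW Vl').
by apply: ereal_sup_ubound; exists n.
Qed.

Lemma limn_esup_ge0 u (l : R) : limn_esup (fun n => (u n)%:E) = l%:E ->
  (forall n, 0 <= u n) -> 0 <= l.
Proof.
move=> ul u0; rewrite -lee_fin -ul; apply: le_ereal_inf_tmp => _ [V [n _ nV] <-].
apply: (@le_trans _ _ (u n)%:E); first by rewrite lee_fin; exact: u0.
by apply: ereal_sup_ubound; exists n => //; apply: nV => /=; exact: leqnn.
Qed.

End limsup.

(** * Powers of n against its logarithm *)

Section powers.
Context {R : realType}.
Variables (N kap : R).
Hypotheses (N1 : 1 <= N) (k0 : 0 < kap).
Let V := N `^ kap.

Let N0 : 0 < N. Proof. exact: lt_le_trans N1. Qed.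

Lemma powR_D a b : N `^ (a + b) = N `^ a * N `^ b.
Proof. by rewrite powRD// (gt_eqF N0) implybT. Qed.

Lemma powR_le_expV (a : R) k : a <= - (k%:R * kap) -> N `^ a <= V ^- k.
Proof.
move=> ak; rewrite /V -powR_mulrn ?powR_ge0// -powRrM -powRN; apply: ler_powR => //.
by rewrite (mulrC kap).
Qed.

Lemma ln_le_powR : ln N <= V / kap.
Proof.
rewrite ler_pdivlMr// mulrC -ln_powR; apply/ltW/ln_sublinear.
exact: powR_gt0.
Qed.

Lemma powR_expR a : N `^ a = expR (a * ln N).
Proof. by rewrite /powR gt_eqF. Qed.

Variables (lam x : R).
Hypotheses (lam0 : 0 <= lam) (xlam : x ^+ 2 <= lam * ln N).

(** x^2 <= lam ln N <= (lam / kap) V <= V^2 / 4 <= (V - 1)^2. *)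
Lemma abs_le_powR : 2 <= V -> 4 * lam / kap <= V -> 1 + `|x| <= V.
Proof.
move=> V2 lV; have V0 : 0 <= V - 1 by lra.
suff : `|x| <= V - 1 by lra.
rewrite -(@ler_pXn2r _ 2)// ?nnegrE// real_normK ?num_real//.
apply: (le_trans xlam).
have h := ler_wpM2l lam0 ln_le_powR.
have h2 : lam * (V / kap) = (4 * lam / kap) * V / 4 by field; rewrite gt_eqF.
have : (4 * lam / kap) * V <= V * V by rewrite ler_wpM2r//; lra.
move: h; rewrite h2; nra.
Qed.

(** The yardstick for additive errors: by the Mills ratio, the tail is at least of order N^(- lam /
    2) / V. *)
Lemma gtail_ge_powR : 1 + `|x| <= V ->
  normal_peak 1 * N `^ (- (lam / 2)) <= V * gtail x.
Proof.
move=> xV; apply: (@le_trans _ _ (gpdf x)).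
  rewrite gpdfE ler_wpM2l ?normal_peak_ge0// powR_expR ler_expR; have := xlam; lra.
by apply: (le_trans (gpdf_le_gtail x)); rewrite ler_wpM2r// gtail_ge0.
Qed.

(** After taking logarithms, the loss on the right is linear in ln N, hence in V since ln N <= V /
    kap, while the left decreases like V^2 / 2. *)
Lemma gauss_le_gtail : 1 + `|x| <= V -> 1 <= V ->
  2 * ((lam / 2 + 2 * kap) / kap + `|ln (normal_peak 1)|) <= V ->
  expR (- (V ^+ 2 / 2)) <= V^-1 * gtail x.
Proof.
move=> xV V1 AV; have V0 : 0 < V by lra.
rewrite [leRHS]mulrC ler_pdivlMr//.
have g := gtail_ge_powR xV.
rewrite -(ler_pM2l V0); apply: le_trans g.
have p0 := @normal_peak1_gt0 R.
rewrite -[X in _ <= X * _](lnK p0) powR_expR -expRD.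
have -> : V * (expR (- (V ^+ 2 / 2)) * V) = expR (2 * kap * ln N) * expR (- (V ^+ 2 / 2)).
  have -> : expR (2 * kap * ln N) = V * V.
    by rewrite -powR_expR /V -powR_D; congr (_ `^ _); ring.
  by ring.
rewrite -expRD ler_expR.
have lnN := ln_le_powR.
have h : (lam / 2 + 2 * kap) * ln N <= (lam / 2 + 2 * kap) / kap * V.
  rewrite mulrAC -mulrA; apply: ler_wpM2l => //; have := lam0; have := k0; lra.
have l0 := normr_ge0 (ln (normal_peak 1 : R)).
have l1 : - ln (normal_peak 1 : R) <= `|ln (normal_peak 1)| by rewrite -normrN ler_norm.
have l2 : `|ln (normal_peak 1 : R)| <= `|ln (normal_peak 1)| * V by rewrite ler_peMr.
have l3 : 2 * ((lam / 2 + 2 * kap) / kap + `|ln (normal_peak 1)|) * V <= V * V.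
  by rewrite ler_wpM2r// ltW.
rewrite expr2; nra.
Qed.

End powers.

(** * The relative error for one n *)

Section tail_ratio.
Context {d : measure_display} {T : measurableType d} {R : realType}.
Variables (P : probability T R) (X : nat -> {RV P >-> R}).
Hypothesis Xst : strictly_stationary P (fun n => X n).
Hypothesis Xassoc : associated P (fun n => X n).
Hypothesis Xsq : forall n, sqi P (X n).
Hypothesis Xuncor : forall i j, (i < j)%N -> cv P (X i) (X j) = 0.
Hypothesis X0 : Ex P (X 0) = 0.
Variable q : R.
Hypothesis q2 : 2 < q.
Hypothesis Xq : itg P (fun w => `|X 0 w| `^ q).
Let K := Ex P (fun w => `|X 0 w| `^ q).

(** The shifts by - V^-3 and V^-3 bracket the probability. [close_const] pays for smoothing and
    replacement; the added 2 pays for the indicator and for the truncated paths. *)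
Lemma tail_ratio (n : nat) (s tau V x : R) : (0 < n)%N -> 0 < s -> 0 < tau ->
  s ^+ 2 = n%:R * Ex P (fun w => X 0 w ^+ 2) ->
  8 <= V -> expR 1 <= V -> 1 + `|x| <= V -> 2 * V * (tau / s) <= 1 ->
  n%:R * (K * tau `^ (1 - q) / s) + n%:R * (K * tau `^ (2 - q) / s ^+ 2) +
    tau / s + n%:R^-1 <= V ^- 33 ->
  expR (- (V ^+ 2 / 2)) <= V^-1 * gtail x ->
  n%:R * (K * tau `^ (- q)) <= V^-1 * gtail x ->
  `|fine (P [set w | x * s < \sum_(k < n) X k w]) / gtail x - 1| <= (close_const + 2) / V.
Proof.
move=> n0 s0 t0 s2 V8 Ve xV Vts HE kg eg.
have V0 : 0 < V by lra.
have V1 : 1 <= V by lra.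
have HE' := le_trans (lerr_trunc_le Xsq X0 q2 Xq n0 s0 t0 s2) HE.
have V30 : 0 <= V ^- 3 by rewrite invr_ge0 exprn_ge0// ltW.
have close y : `|y - x| <= V ^- 3 -> _ := fun yx =>
  smooth_close Xst Xassoc Xsq Xuncor (trunc_incr s0 t0) (trunc_le s0 t0)
    n0 V8 Ve xV yx Vts HE'.
have c1 : `|x - V ^- 3 - x| <= V ^- 3 by rewrite addrAC subrr sub0r normrN ger0_norm.
have c2 : `|x + V ^- 3 - x| <= V ^- 3 by rewrite addrAC subrr add0r ger0_norm.
have := close _ c1; have := close _ c2.
have := prob_upper Xst q2 Xq n s0 t0 x V1; have := prob_lower Xst q2 Xq n s0 t0 x V1.
rewrite -/K; set p := fine _; set Wl := Ex P _; set Wu := Ex P _.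
set kp := expR (- _) in kg *; set ep := n%:R * _ in eg *.
move=> lo up /ler_normlP[cl1 cl2] /ler_normlP[cu1 cu2].
have g0 := gtail_gt0 x.
have -> : p / gtail x - 1 = (p - gtail x) / gtail x by field; rewrite gt_eqF.
rewrite normrM (gtr0_norm (_ : 0 < (gtail x)^-1)) ?invr_gt0// ler_pdivrMr//.
have E : (close_const + 2) / V * gtail x =
  close_const * V^-1 * gtail x + V^-1 * gtail x + V^-1 * gtail x by ring.
rewrite E ler_norml; set cg := close_const * V^-1 * gtail x in cl1 cl2 cu1 cu2 *.
apply/andP; split; lra.
Qed.

End tail_ratio.

(** * Checking the exponents *)

Section rates.
Context {R : realType}.
Variables (N q eps sg K kap : R).
Hypotheses (N1 : 1 <= N) (q2 : 2 < q) (epsq : eps * q = (q - 2) / 4).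
Hypotheses (sg0 : 0 < sg) (K0 : 0 <= K) (k0 : 0 < kap) (keps : 34 * kap <= eps).
Let s := sg * N `^ 2^-1.
Let tau := N `^ (2^-1 - eps).
Let V := N `^ kap.

Let N0 : 0 < N. Proof. exact: lt_le_trans N1. Qed.

Let e0 : 0 < eps. Proof. by have := keps; have := k0; lra. Qed.

Let e1 : eps <= 4^-1. Proof. by have := e0; have := q2; have := epsq; nra. Qed.

Let Ns : s^-1 = sg^-1 * N `^ (- 2^-1).
Proof. by rewrite /s invfM powRN. Qed.

Let Nr : N = N `^ 1. Proof. by rewrite powRr1// ltW. Qed.

Let tauE a : tau `^ a = N `^ ((2^-1 - eps) * a). Proof. by rewrite -powRrM. Qed.

Let Npow a : a <= - eps -> N `^ a <= V ^- 34.
Proof.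
move=> ae; apply: powR_le_expV => //; apply: (le_trans ae).
by rewrite lerN2; exact: keps.
Qed.

Let V0 : 0 < V. Proof. exact: powR_gt0. Qed.

(** One power of V beyond the required 33 is kept in reserve to absorb the constants. *)
Let V34 C : 0 <= C -> C <= V -> C * V ^- 34 <= V ^- 33.
Proof.
move=> C0 CV; have -> : V ^- 33 = V * V ^- 34 by field; rewrite gt_eqF.
by rewrite ler_wpM2r// invr_ge0 exprn_ge0// ltW.
Qed.

Lemma rate_ratio : tau / s = sg^-1 * N `^ (- eps).
Proof.
rewrite Ns mulrCA /tau -(powR_D N1); congr (_ * _ `^ _); ring.
Qed.

(** The exponent is 1 - q/2 + eps q: half of the gain (q - 2)/2 of the moment assumption is spent on
    lowering the truncation level. *)
Lemma rate_tail : N * (K * tau `^ (- q)) = K * N `^ (- ((q - 2) / 4)).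
Proof.
rewrite tauE {1}Nr mulrCA -(powR_D N1) -epsq; congr (_ * _ `^ _).
by have := epsq; lra.
Qed.

(** All four terms decay at least like N^(- eps). The mean and variance defects have exponents - (q
    - 2)/4 - eps and - (q - 2)/4 - 2 eps; the third moment term is exactly of order N^(- eps). *)
Lemma rate_sum : K / sg + K / sg ^+ 2 + sg^-1 + 1 <= V ->
  N * (K * tau `^ (1 - q) / s) + N * (K * tau `^ (2 - q) / s ^+ 2) + tau / s + N^-1 <= V ^- 33.
Proof.
move=> CV; have si : 0 <= sg^-1 by rewrite invr_ge0 ltW.
apply: le_trans (V34 _ CV); last first.
  by rewrite !addr_ge0// mulr_ge0// invr_ge0 exprn_ge0// ltW.
rewrite !mulrDl mul1r; apply: lerD; last first.
  rewrite -(powR_inv1 (ltW N0)); apply: Npow; have := e1; lra.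
apply: lerD; last by rewrite rate_ratio ler_wpM2l// Npow.
apply: lerD.
  have -> : N * (K * tau `^ (1 - q) / s) = K / sg * N `^ (1 + (2^-1 - eps) * (1 - q) - 2^-1).
    by rewrite !(powR_D N1) -Nr Ns -tauE; ring.
  rewrite ler_wpM2l ?mulr_ge0//; apply: Npow; have := epsq; have := q2; lra.
have -> : N * (K * tau `^ (2 - q) / s ^+ 2) = K / sg ^+ 2 * N `^ (1 + (2^-1 - eps) * (2 - q) - 2^-1 - 2^-1).
  by rewrite !(powR_D N1) -Nr -exprVn Ns -tauE -exprVn; ring.
rewrite ler_wpM2l ?mulr_ge0 ?invr_ge0 ?exprn_ge0 ?(ltW sg0)//; apply: Npow.
have := epsq; have := q2; have := e0; nra.
Qed.

Lemma rate_window : 1 <= V -> 2 / sg <= V -> 2 * V * (tau / s) <= 1.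
Proof.
move=> V1 sV; rewrite rate_ratio.
have si : 0 <= sg^-1 by rewrite invr_ge0 ltW.
apply: (@le_trans _ _ (2 * V * (sg^-1 * V ^- 34))).
  rewrite ler_wpM2l ?mulr_ge0 ?(ltW V0)// ler_wpM2l// Npow//.
have -> : 2 * V * (sg^-1 * V ^- 34) = 2 / sg * V ^- 33 by field; rewrite !gt_eqF.
apply: (@le_trans _ _ (V * V ^- 33)).
  by rewrite ler_wpM2r// invr_ge0 exprn_ge0// ltW.
have -> : V * V ^- 33 = V ^- 32 by field; rewrite gt_eqF.
by rewrite invf_le1 ?exprn_gt0// exprn_ege1.
Qed.

(** The bound on lam enters here: the truncation cost N^(-(q - 2)/4) beats the order N^(- lam / 2)
    of the tail by at least V^34. *)
Lemma rate_truncation (lam g : R) : 34 * kap <= (q - 2) / 4 - lam / 2 -> 1 <= V ->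
  K / normal_peak 1 <= V -> normal_peak 1 * N `^ (- (lam / 2)) <= V * g ->
  N * (K * tau `^ (- q)) <= V^-1 * g.
Proof.
move=> kl V1 KV gV; rewrite rate_tail.
have p0 := @normal_peak1_gt0 R.
have -> : - ((q - 2) / 4) = - (lam / 2) + (lam / 2 - (q - 2) / 4) by ring.
rewrite (powR_D N1).
have h : N `^ (lam / 2 - (q - 2) / 4) <= V ^- 34.
  by apply: powR_le_expV => //; move: kl; lra.
have -> : V^-1 * g = V ^- 2 * (V * g) by field; rewrite gt_eqF.
have V2 : 0 <= V ^- 2 by rewrite invr_ge0 exprn_ge0// ltW.
apply: le_trans (ler_wpM2l V2 gV).
have -> : K * (N `^ (- (lam / 2)) * N `^ (lam / 2 - (q - 2) / 4)) =
  (K / normal_peak 1) * N `^ (lam / 2 - (q - 2) / 4) * (normal_peak 1 * N `^ (- (lam / 2))).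
  by field; rewrite gt_eqF.
rewrite ler_wpM2r ?mulr_ge0 ?normal_peak_ge0 ?powR_ge0//.
apply: (@le_trans _ _ (V * V ^- 34)).
  by rewrite ler_pM ?powR_ge0// divr_ge0// normal_peak_ge0.
have -> : V * V ^- 34 = V ^- 33 by field; rewrite gt_eqF.
by rewrite lef_pV2 ?posrE ?exprn_gt0// ler_weXn2l.
Qed.

End rates.

(** * Fixing the exponents and passing to the limit *)

Theorem theorem5p5 (d : measure_display) (T : measurableType d) (R : realType)
  (P : probability T R) (X : nat -> {RV P >-> R}) (q theta : R)
  (x : nat -> R) (lambda : R) :
  strictly_stationary P (fun n => X n) ->
  (forall n, ('E_P[X n] = 0)%E) ->
  (forall n, P.-integrable [set: T] (EFin \o (fun w => X n w ^+ 2))) ->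
  associated P (fun n => X n) ->
  cvgn (series (fun j => cov_seq P (fun n => X n) j.+1)) ->
  0 < sigma2 P (fun n => X n) ->
  (* (A1) *)
  2 < q ->
  P.-integrable [set: T] (EFin \o (fun w => `|X 0%N w| `^ q)) ->
  (* (A2) *)
  0 < theta ->
  (exists C : R, \forall n \near \oo,
     `|sn P (fun n => X n) n ^+ 2 / (n%:R * sigma2 P (fun n => X n)) - 1|
       <= C * (n%:R `^ (- theta))) ->
  (* (i) *)
  limn_esup (fun n => ((x n ^+ 2) / ln (n%:R))%:E) = lambda%:E ->
  lambda < (q - 2) / 2 ->
  (* (ii) *)
  1 + lambda < theta ->
  (fun n => fine (P [set w | x n * sn P (fun n => X n) n < partial_sum (fun n => X n) n w])
            / (1 - Phi (x n))) @ \oo --> (1 : R).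
Proof.
move=> Xst XE Xsq Xassoc Xsum sig0 q2 Xq _ rate xlim lamq lamth.
(* Nonnegativity of lambda turns (ii) into theta > 1, the rate that removes the covariances. *)
have lam0 : 0 <= lambda.
  (* At n = 0 the default values [ln 0 = 0] and 0^-1 = 0 make the quotient vanish. *)
  apply: limn_esup_ge0 xlim _ => -[|n]; first by rewrite ln0// invr0 mulr0.
  by rewrite mulr_ge0 ?sqr_ge0// invr_ge0 ln_ge0// ler1n.
have th1 : 1 < theta by lra.
have [Xuncor sigE snE] := uncorrelated_of_rate Xst XE Xsq Xassoc Xsum sig0 th1 rate.
have Xs n : sqi P (X n) by split => //; exact: Xsq.
have X00 : Ex P (X 0) = 0 by rewrite -fine_expectation XE.
set v := Ex P (fun w => X 0 w ^+ 2) in sigE snE; rewrite sigE in sig0.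
pose K := Ex P (fun w => `|X 0 w| `^ q).
have K0 : 0 <= K by apply: Ex_ge0 => w; exact: powR_ge0.
pose sg := Num.sqrt v; have sg0 : 0 < sg by rewrite sqrtr_gt0.
(* The midpoint leaves strict room on both sides: above lambda for the eventual bound on x_n^2,
   below (q - 2)/2 for [rho] > 0. *)
pose lam := (lambda + (q - 2) / 2) / 2.
have laml : lambda < lam by rewrite /lam; lra.
have lam_ge0 : 0 <= lam by lra.
pose eps := (q - 2) / (4 * q).
have epsq : eps * q = (q - 2) / 4 by rewrite /eps; field; rewrite gt_eqF//; lra.
have eps0 : 0 < eps by rewrite divr_gt0//; lra.
pose rho := (q - 2) / 4 - lam / 2.
have rho0 : 0 < rho by rewrite /rho /lam; lra.
(* V^34 must stay below both n^eps, for the replacement errors, and n^rho, for the truncation error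
   relative to the tail. *)
pose kap := Num.min eps rho / 34.
have k0 : 0 < kap by rewrite divr_gt0// lt_min eps0.
have keps : 34 * kap <= eps by rewrite /kap mulrC divfK// ge_min lexx.
have krho : 34 * kap <= rho by rewrite /kap mulrC divfK// ge_min lexx orbT.
have Vlarge (M : R) : \forall n \near \oo, M <= n%:R `^ kap.
  near=> n; apply: (@le_trans _ _ (Num.max M 1)); first by rewrite le_max lexx.
  have M0 : 0 <= Num.max M 1 by rewrite le_max ler01 orbT.
  have -> : Num.max M 1 = (Num.max M 1 `^ kap^-1) `^ kap.
    by rewrite -powRrM mulVf ?gt_eqF// powRr1.
  apply: ge0_ler_powR; rewrite ?nnegrE ?powR_ge0//; first exact: ltW.
  by near: n; exact: nbhs_infty_ger.
have xlam := limn_esup_near_le xlim laml.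
have ratio : \forall n \near \oo,
  `|fine (P [set w | x n * sn P (fun n => X n) n < partial_sum (fun n => X n) n w])
     / (1 - Phi (x n)) - 1| <= (close_const + 2) / n%:R `^ kap.
  near=> n.
  have n2 : (1 < n)%N by near: n; exact: nbhs_infty_gt.
  have n0 : (0 < n)%N by exact: ltnW.
  have N1 : 1 <= n%:R :> R by rewrite ler1n.
  have xn : x n ^+ 2 <= lam * ln n%:R.
    have : x n ^+ 2 / ln n%:R <= lam by near: n; exact: xlam.
    by rewrite ler_pdivrMr// ln_gt0// ltr1n.
  have V8 : 8 <= n%:R `^ kap by near: n; exact: Vlarge.
  have V1 : 1 <= n%:R `^ kap by lra.
  have V2 : 2 <= n%:R `^ kap by lra.
  have Vlam : 4 * lam / kap <= n%:R `^ kap by near: n; exact: Vlarge.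
  have xV := abs_le_powR N1 k0 lam_ge0 xn V2 Vlam.
  have gV := gtail_ge_powR N1 xn xV.
  pose s := sg * n%:R `^ 2^-1; pose tau := n%:R `^ (2^-1 - eps) : R.
  have s0 : 0 < s by rewrite mulr_gt0// powR_gt0// ltr0n.
  have t0 : 0 < tau by rewrite powR_gt0// ltr0n.
  have s2 : s ^+ 2 = n%:R * v.
    rewrite /s exprMn sqr_sqrtr ?ltW// powR12_sqrt// sqr_sqrtr//; exact: mulrC.
  have -> : sn P (fun n => X n) n = s.
    apply/eqP; rewrite -(@eqrXn2 _ 2)// ?sqrtr_ge0 ?(ltW s0)//.
    by rewrite snE s2.
  apply: (tail_ratio Xst Xassoc Xs Xuncor X00 q2 Xq n0 s0 t0 s2 V8) => //.
  - by near: n; exact: Vlarge.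
  - apply: rate_window N1 sg0 keps V1 _; near: n; exact: Vlarge.
  - apply: rate_sum N1 q2 epsq sg0 K0 k0 keps _; near: n; exact: Vlarge.
  - apply: (@gauss_le_gtail R _ _ N1 k0 _ _ lam_ge0 xn xV V1).
    by near: n; exact: Vlarge.
  - apply: (rate_truncation N1 epsq K0 krho V1 _ gV).
    by near: n; exact: Vlarge.
apply/cvgrPdist_le => e e0; near=> n.
have c0 := @close_const_ge0 R.
have V0 : 0 < n%:R `^ kap :> R by rewrite powR_gt0// ltr0n; near: n; exact: nbhs_infty_gt.
rewrite distrC; apply: (@le_trans _ _ ((close_const + 2) / n%:R `^ kap)).
  by near: n; exact: ratio.
rewrite ler_pdivrMr// mulrC -ler_pdivrMr//; near: n; exact: Vlarge.
Unshelve. all: by end_near. Qed.
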